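(* Let $E_{12},E_{13},E_{23}$ be independent $\operatorname{Exp}(1)$ variables, put $T_1=\min(E_{12},E_{13})$, $T_2=\min(E_{12},E_{23})$, $T_3=\min(E_{13},E_{23})$, and $U_i=1-\exp(-2T_i)$ for $i=1,2,3$. Let $w_i>0$ with $w_1+w_2+w_3=1$, put $\sigma_2(\boldsymbol w)=\sum_{i<j}w_iw_j$, and let $$R_{\boldsymbol w}=\sum_{i=1}^3\frac{w_i}{U_i},\qquad T_{\boldsymbol w}=\sum_{i=1}^3w_i\cot(\pi U_i/2).$$ For $S\in\{R,T\}$ set $c_R=1$, $c_T=2/\pi$, let $F^\Pi_{S,\boldsymbol w}$ be the distribution function of the same statistic, with the same weights, when $U_1,U_2,U_3$ are replaced by independent uniform$(0,1)$ variables, and let $q_{\Pi,S,\boldsymbol w}(\alpha)$ be the upper $\alpha$-quantile of $F^\Pi_{S,\boldsymbol w}$. Then, for $S\in\{R,T\}$, as $t\to\infty$, $$\Pr(S_{\boldsymbol w}>t)-\{1-F^\Pi_{S,\boldsymbol w}(t)\}=-c_S^2\,\sigma_2(\boldsymbol w)\frac{\log t}{t^2}+O(t^{-2}).$$ Consequently, as $\alpha\downarrow0$, $$\Pr\{S_{\boldsymbol w}>q_{\Pi,S,\boldsymbol w}(\alpha)\}=\alpha-\sigma_2(\boldsymbol w)\alpha^2\log(1/\alpha)+O(\alpha^2),$$ whereas at the first-order threshold $c_S/\alpha$, $$\Pr(S_{\boldsymbol w}>c_S/\alpha)=\alpha+\sigma_2(\boldsymbol w)\alpha^2\log(1/\a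lpha)+O(\alpha^2).$$
   Context: Each $U_i$ above is exactly uniform$(0,1)$. The upper $\alpha$-quantile $q$ of a continuous distribution function $F$ satisfies $1-F(q)=\alpha$. *)

(* Defs.v *)
From HB Require Import structures.
From mathcomp Require Import all_boot all_order all_algebra.
From mathcomp Require Import all_classical all_reals all_analysis.
From mathcomp Require Import measurable_realfun.

Set Implicit Arguments.
Unset Strict Implicit.
Unset Printing Implicit Defensive.

Import Order.TTheory GRing.Theory Num.Theory.
Import numFieldNormedType.Exports.

Local Open Scope classical_set_scope.
Local Open Scope ring_scope.

(* The O_F notations look up F among the canonical [filter_on] structures, which
   the library does not declare for these two filters. *)
Canonical pinfty_filter_on (R : numFieldType) :=
  FilterType (pinfty_nbhs R) (@filter_filter _ _ (@proper_pinfty_nbhs R)).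

Canonical at_right_filter_on (R : numFieldType) (x : R) :=
  FilterType (at_right x) (@filter_filter _ _ (at_right_proper_filter x)).

(* A measure is only specified on measurable sets, so laws are compared there
   rather than as functions on all sets. *)
Definition has_law d (T : measurableType d) (R : realType)
    (P : probability T R) (X : {RV P >-> R}) (mu : set R -> \bar R) : Prop :=
  forall A : set R, measurable A -> distribution P X A = mu A.

(* The product rule for subfamilies is included: take A i := setT outside of
   the subfamily. *)
Definition mutually_independent (I : finType) d (T : measurableType d)
    (R : realType) (P : probability T R) (X : I -> {RV P >-> R}) : Prop :=
  forall A : I -> set R, (forall i, measurable (A i)) ->
    P (\bigcap_(i in [set: I]) (X i @^-1` A i)) =
    (\prod_(i : I) P (X i @^-1` A i))%E.

Definition triple (A : Type) (a b c : A) : 'I_3 -> A := tnth [tuple a; b; c].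

Definition cot (R : realType) (x : R) : R := cos x / sin x.

Inductive statistic := StatR | StatT.

(* At u = 0 both scores take the junk value 0 coming from 0^-1 = 0; this only
   concerns a null event. *)
Definition score (R : realType) (S : statistic) (u : R) : R :=
  match S with
  | StatR => u^-1
  | StatT => cot (pi * u / 2)
  end.

Definition tail_const (R : realType) (S : statistic) : R :=
  match S with
  | StatR => 1
  | StatT => 2 / pi
  end.

Definition sigma2 (R : realType) (w : 'I_3 -> R) : R :=
  \sum_(i < 3) \sum_(j < 3 | (i < j)%N) w i * w j.

Section measurability.
Context {R : realType}.

Lemma measurable_inv : measurable_fun [set: R] (fun x : R => x^-1).
Proof.
rewrite -(setUv [set (0 : R)]); apply/measurable_funU => //.
  exact: measurableC.
split; first exact: measurable_fun_set1.
apply: open_continuous_measurable_fun.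
  by rewrite openC; exact: closed_eq.
by move=> x /set_mem /= /eqP x0; exact: inv_continuous.
Qed.

Lemma measurable_score (S : statistic) : measurable_fun [set: R] (@score R S).
Proof.
case: S; first exact: measurable_inv.
have mh : measurable_fun [set: R] (fun u : R => pi * u / 2).
  by apply: measurable_funM => //; exact: measurable_funM.
apply: measurable_funM.
  by apply: measurableT_comp mh; apply: continuous_measurable_fun;
    exact: continuous_cos.
apply: (measurableT_comp measurable_inv).
by apply: measurableT_comp mh; apply: continuous_measurable_fun;
  exact: continuous_sin.
Qed.

End measurability.

Section random_variables.
Context d (T : measurableType d) (R : realType) (P : probability T R).

Definition min_unif (E E' : {RV P >-> R}) (x : T) : R :=
  1 - expR (- (2 * Num.min (E x) (E' x))).

Lemma measurable_min_unif (E E' : {RV P >-> R}) :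
  measurable_fun [set: T] (min_unif E E').
Proof.
apply: measurable_funB => //; apply: measurableT_comp => //.
apply: measurableT_comp => //; apply: measurable_funM => //.
exact: measurable_minr.
Qed.

HB.instance Definition _ (E E' : {RV P >-> R}) :=
  isMeasurableFun.Build _ _ _ _ (min_unif E E') (measurable_min_unif E E').

Definition marginals (E12 E13 E23 : {RV P >-> R}) : 'I_3 -> {RV P >-> R} :=
  triple (min_unif E12 E13 : {RV P >-> R}) (min_unif E12 E23) (min_unif E13 E23).

Definition combined (S : statistic) (w : 'I_3 -> R) (U : 'I_3 -> {RV P >-> R})
    (x : T) : R :=
  \sum_(i < 3) w i * score S (U i x).

Lemma measurable_combined S w (U : 'I_3 -> {RV P >-> R}) :
  measurable_fun [set: T] (combined S w U).
Proof.
apply: measurable_sum => i; apply: measurable_funM => //.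
exact: measurableT_comp (measurable_score S) _.
Qed.

HB.instance Definition _ S w (U : 'I_3 -> {RV P >-> R}) :=
  isMeasurableFun.Build _ _ _ _ (combined S w U) (measurable_combined S w U).

Definition distrib_fun (X : {RV P >-> R}) (t : R) : R := fine (cdf X t).

Definition prob_gt (X : {RV P >-> R}) (t : R) : R :=
  fine (P [set x | t < X x]).

End random_variables.

Arguments has_law {d T R} P X mu.
Arguments mutually_independent {I d T R} P X.
Arguments distrib_fun {d T R} P X t.
Arguments prob_gt {d T R} P X t.

(* "The" q with 1 - F q = a, by choice; get returns a default value if there is
   none, which does not happen for 0 < a < 1 when F is continuous. *)
Definition upper_quantile (R : realType) (F : R -> R) (a : R) : R :=
  get [set q | 1 - F q = a].

(* Main.v *)
Require Import Defs.
From HB Require Import structures.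
From mathcomp Require Import all_boot all_order all_algebra.
From mathcomp Require Import all_classical all_reals all_analysis.
From mathcomp Require Import measurable_realfun.
From mathcomp Require Import ring lra.

(**
One big jump. Write [R] for the statistic built from the scores [1/U_i]. Since
[c/u - 1 <= score u <= c/u] on (0, 1), the tail of either statistic at [t] lies
between the tails of [R] at [(t + 1)/c] and [t/c], and such a shift costs only
[O(t^-2)]; so it is enough to expand the tail of [R].

If [X], [Y] are independent with tails [a/x + O(x^-2)] and [b/y + O(y^(-3/2))],
slicing according to the integer part of [Y] gives
[P(X + Y > t, Y <= t/2) = a/t + a b ln t/t^2 + O(t^-2)], the logarithm being
the truncated mean of [Y]. Up to an event of probability [O(t^-2)] on which two
of three underlying independent variables are of order [t], [R > t] is the
disjoint union of three events of this form. For independent uniforms,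
[X = w_i/U_i] and [Y] is the rest of the sum, whence the coefficient
[sum_i w_i (1 - w_i) = 2 sigma2 w] of [ln t/t^2]. For the shared exponentials
put [Z_ij = 1/(1 - exp(-2 E_ij))], so that [1/U_1 = max(Z_12, Z_13)] and so on;
where [Z_ij] is the largest of the three,
[R = (w_i + w_j) Z_ij + w_k max(Z_ik, Z_jk)], and [P(Z_ij > x) ~ 1/(2x)] gives
the coefficient [sum_k (1 - w_k) w_k / 2 = sigma2 w].

The quantile exists because [F] has no atoms, and it is [c/a (1 + O(a ln(1/a)))].
*)

Set Implicit Arguments.
Unset Strict Implicit.
Unset Printing Implicit Defensive.

Import Order.TTheory GRing.Theory Num.Theory.
Import numFieldNormedType.Exports.

Local Open Scope classical_set_scope.
Local Open Scope ring_scope.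

(** * Harmonic sums and Abel summation *)

Lemma ln_le_subr1 (R : realType) (x : R) : 0 < x -> ln x <= x - 1.
Proof.
move=> x0; have /le_ln1Dx : -1 < x - 1 by lra.
by rewrite addrC subrK.
Qed.

Lemma ln_addr1_le (R : realType) (x : R) : 0 < x -> ln (x + 1) <= ln x + x^-1.
Proof.
move=> x0; have i0 : 0 < x^-1 by rewrite invr_gt0.
have -> : x + 1 = x * (1 + x^-1) by rewrite mulrDr mulfV ?gt_eqF // mulr1.
rewrite lnM ?posrE ?addr_gt0 // lerD2l le_ln1Dx //.
by apply: lt_trans i0; rewrite ltrN10.
Qed.

Lemma ln_addr1_ge (R : realType) (x : R) :
  0 < x -> ln x + (x + 1)^-1 <= ln (x + 1).
Proof.
move=> x0; have x10 : 0 < x + 1 by lra.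
have := ln_le_subr1 (divr_gt0 x0 x10); rewrite ln_div ?posrE //.
have -> : x / (x + 1) - 1 = - (x + 1)^-1 by field; lra.
by rewrite lerBlDr addrC lerBrDr.
Qed.

Lemma harmonic_ge (R : realType) (n : nat) :
  ln (n.+1%:R : R) <= \sum_(k < n) (k.+1%:R : R)^-1.
Proof.
elim: n => [|n IH]; first by rewrite big_ord0 ln1.
rewrite big_ord_recr /=; apply: (le_trans _ (lerD IH (lexx _))).
by rewrite -(natr1 n.+1) ln_addr1_le.
Qed.

Lemma harmonic_le (R : realType) (n : nat) :
  \sum_(k < n.+1) (k.+1%:R : R)^-1 <= 1 + ln (n.+1%:R : R).
Proof.
elim: n => [|n IH]; first by rewrite big_ord1 ln1 invr1 addr0.
rewrite big_ord_recr /=; apply: (le_trans (lerD IH (lexx _))).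
by rewrite -addrA lerD2l -(natr1 n.+1) ln_addr1_ge.
Qed.

(** The power [x^(3/2)]. An error of this order in the tail of [Y] is summable over the integers, so
    it moves the truncated mean only by a bounded amount. *)
Definition pow32 (R : realType) (x : R) : R := x * Num.sqrt x.

Lemma pow32_gt0 (R : realType) (y : R) : 0 < y -> 0 < pow32 y.
Proof. by move=> y0; rewrite /pow32 mulr_gt0 // sqrtr_gt0. Qed.

Lemma pow32_sqr (R : realType) (s : R) : 0 <= s -> pow32 (s ^+ 2) = s ^+ 3.
Proof. by move=> s0; rewrite /pow32 sqrtr_sqr ger0_norm // -exprSr. Qed.

Lemma sum_inv_pow32_le (R : realType) (n : nat) :
  \sum_(k < n) (pow32 (k.+1%:R : R))^-1 <= 3.
Proof.
rewrite /pow32.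
case: n => [|n]; first by rewrite big_ord0.
(* The subtracted [2 / sqrt n] makes the induction telescope. With [a], [b] the roots of consecutive
   integers, [2/a - 2/b = 2 / (a b (a + b))] since [(b - a) (b + a) = 1], and this exceeds [1 / b^3]
   because [a (a + b) <= 2 b^2]. *)
suff : \sum_(k < n.+1) ((k.+1%:R : R) * Num.sqrt k.+1%:R)^-1
       <= 3 - 2 / Num.sqrt n.+1%:R.
  have : 0 <= 2 / Num.sqrt (n.+1%:R : R) by rewrite divr_ge0 // sqrtr_ge0.
  lra.
elim: n => [|n IH]; first by rewrite big_ord1 sqrtr1 mul1r invr1; lra.
rewrite big_ord_recr /=; apply: (le_trans (lerD IH (lexx _))).
set a : R := Num.sqrt n.+1%:R; set b : R := Num.sqrt n.+2%:R.
have a0 : 0 < a by rewrite sqrtr_gt0 ltr0n.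
have b0 : 0 < b by rewrite sqrtr_gt0 ltr0n.
have a2 : a ^+ 2 = n.+1%:R by rewrite sqr_sqrtr.
have b2 : b ^+ 2 = n.+2%:R by rewrite sqr_sqrtr.
have ab2 : b ^+ 2 = a ^+ 2 + 1 by rewrite a2 b2 -addn1 natrD.
have ab : a <= b by rewrite ler_sqrt ?ltr0n // ler_nat.
rewrite -b2.
have -> : (b ^+ 2 * b)^-1 = (a * (a + b)) / (a * b * (b * b) * (a + b)).
  by field; lra.
have -> : 3 - 2 / a = 3 - 2 / b - 2 * b * b / (a * b * (b * b) * (a + b)).
  have e : (b - a) * (b + a) = 1 by rewrite -subr_sqr; lra.
  have -> : 2 * b * b = 2 * b * b * ((b - a) * (b + a)) by rewrite e mulr1.
  field; lra.
have Q0 : 0 < (a * b * (b * b) * (a + b))^-1.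
  by rewrite invr_gt0 !mulr_gt0 // addr_gt0.
have : a * (a + b) / (a * b * (b * b) * (a + b)) <=
   2 * b * b / (a * b * (b * b) * (a + b)).
  by rewrite ler_pM2r //; nra.
lra.
Qed.

Section abel.
Context (R : realType) (p : nat -> R).

(** When [p k = P(Y > k)], the weight [p k - p k.+1] is the mass of the slice [k < Y <= k + 1].
    Summation by parts turns truncated moments of the slice index into sums of tails, whose
    asymptotics are known. *)
Lemma sum_abel1 (n : nat) :
  \sum_(k < n.+1) k%:R * (p k - p k.+1) =
  \sum_(k < n) p k.+1 - n%:R * p n.+1.
Proof.
elim: n => [|n IH]; first by rewrite big_ord1 big_ord0 !mul0r subr0.
rewrite big_ord_recr IH big_ord_recr /= -(addn1 n) natrD; ring.
Qed.

Lemma sum_abel2 (n : nat) :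
  \sum_(k < n.+1) k%:R ^+ 2 * (p k - p k.+1) =
  \sum_(k < n) (2 * k%:R + 1) * p k.+1 - n%:R ^+ 2 * p n.+1.
Proof.
elim: n => [|n IH]; first by rewrite big_ord1 big_ord0 expr0n !mul0r subr0.
rewrite big_ord_recr IH big_ord_recr /= -(addn1 n) natrD; ring.
Qed.

Context (b C : R).
Hypothesis (b0 : 0 <= b) (C0 : 0 <= C) (p_ge0 : forall k, 0 <= p k).
Hypothesis pb : forall k : nat,
  `|p k.+1 - b / (k.+1%:R : R)| <= C / pow32 (k.+1%:R : R).

Lemma sum_tail_le (n : nat) :
  \sum_(k < n.+1) p k.+1 <= b * (1 + ln n.+1%:R) + 3 * C.
Proof.
have h (k : 'I_n.+1) : p k.+1 <=
    b * (k.+1%:R : R)^-1 + C * (pow32 (k.+1%:R : R))^-1.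
  have := pb k; rewrite ler_norml => /andP[_].
  by move: (k.+1%:R : R) (pow32 _) => x y; lra.
apply: (le_trans (ler_sum _ (fun i _ => h i))).
rewrite big_split /= -!mulr_sumr lerD //.
  by rewrite ler_wpM2l // harmonic_le.
by rewrite mulrC ler_wpM2r // sum_inv_pow32_le.
Qed.

Lemma sum_tail_ge (n : nat) :
  b * ln n.+1%:R - 3 * C <= \sum_(k < n) p k.+1.
Proof.
have h (k : 'I_n) : b * (k.+1%:R : R)^-1 - C * (pow32 (k.+1%:R : R))^-1 <=
    p k.+1.
  have := pb k; rewrite ler_norml => /andP[+ _].
  by move: (k.+1%:R : R) (pow32 _) => x y; lra.
apply: (le_trans _ (ler_sum _ (fun i _ => h i))).
rewrite big_split /= sumrN -!mulr_sumr lerB //.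
  by rewrite ler_wpM2l // harmonic_ge.
by rewrite mulrC ler_wpM2r // sum_inv_pow32_le.
Qed.

Lemma tail_le (k : nat) : p k.+1 <= (b + C) / k.+1%:R.
Proof.
have := pb k; rewrite ler_norml => /andP[_].
have k0 : 0 < (k.+1%:R : R) by rewrite ltr0n.
have : C / pow32 (k.+1%:R : R) <= C / k.+1%:R.
  rewrite /pow32 ler_wpM2l // lef_pV2 ?posrE ?mulr_gt0 ?sqrtr_gt0 //.
  have s1 : 1 <= Num.sqrt (k.+1%:R : R) by rewrite -{1}sqrtr1 ler_sqrt ?ler1n.
  by rewrite ler_peMr // ltW.
by rewrite mulrDl; move: (k.+1%:R : R) (pow32 _) => x y; lra.
Qed.

(** Since [p k.+1] is at most [(b + C) / (k + 1)], every term is bounded, so the truncated second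
    moment grows only linearly. *)
Lemma sum_sqr_tail_le (n : nat) :
  \sum_(k < n) (2 * k%:R + 1) * p k.+1 <= 2 * n%:R * (b + C).
Proof.
have h (k : 'I_n) : (2 * k%:R + 1) * p k.+1 <= 2 * (b + C).
  have k0 : 0 < (k.+1%:R : R) by rewrite ltr0n.
  have kk : (k.+1%:R : R) = k%:R + 1 by rewrite -addn1 natrD.
  have h0 : 0 <= (k%:R : R) by [].
  have := tail_le k; rewrite ler_pdivlMr // kk => h1.
  have := p_ge0 k.+1; nra.
apply: (le_trans (ler_sum _ (fun i _ => h i))).
by rewrite sumr_const card_ord -mulr_natl; lra.
Qed.

End abel.

Lemma sum_decrements (R : realType) (p : nat -> R) (n : nat) :
  p 0%N = 1 -> \sum_(k < n) (p k - p k.+1) = 1 - p n.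
Proof.
move=> p0; elim: n => [|n IH]; first by rewrite big_ord0 p0 subrr.
by rewrite big_ord_recr /= IH; ring.
Qed.

(* The slices [k < Y <= k + 1] turn the probability [u] of the event
   [X + Y > t, Y <= t / 2] into sums against the increments of the tail [p]
   of [Y], [g] being the tail of [X]. *)
Lemma sliced_tail_le (R : realType) (a b C : R) (p : nat -> R) (g : R -> R)
    (K : nat) (t u : R) :
  0 <= a -> 0 <= b -> 0 <= C ->
  8 <= t -> K.+1%:R <= t / 2 -> t / 2 < K.+1%:R + 1 ->
  p 0%N = 1 -> (forall k, 0 <= p k) -> (forall k, p k.+1 <= p k) ->
  (forall k : nat,
    `|p k.+1 - b / (k.+1%:R : R)| <= C / pow32 (k.+1%:R : R)) ->
  (forall x, 1 <= x -> `|g x - a / x| <= C / x ^+ 2) ->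
  u <= \sum_(k < K.+2) (p k - p k.+1) * g (t - k%:R - 1) ->
  u - a / t - a * b * (ln t / t ^+ 2) <=
    (a * (b + 3 * C) + 8 * a * (b + C) + 3 * a + 16 * C) / t ^+ 2.
Proof.
move=> a0 b0 C0 t8 Kt tK p0 p_ge0 p_dec pb gb u_le.
have t0 : 0 < t by lra.
have it0 : 0 < t^-1 by rewrite invr_gt0.
have it2 : 0 < (t ^+ 2)^-1 by rewrite invr_gt0 exprn_gt0.
have d0 k : 0 <= p k - p k.+1 by rewrite subr_ge0.
have K10 : 0 < (K.+1%:R : R) by rewrite ltr0n.
have it3 : 0 < (t ^+ 3)^-1 by rewrite invr_gt0 exprn_gt0.
have h (k : 'I_K.+2) : (p k - p k.+1) * g (t - k%:R - 1) <=
   (p k - p k.+1) * (a / t + (3 * a + 16 * C) / t ^+ 2)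
   + a / t ^+ 2 * (k%:R * (p k - p k.+1))
   + 8 * a / t ^+ 3 * (k%:R ^+ 2 * (p k - p k.+1)).
  have kK : (k%:R : R) <= K.+1%:R by rewrite ler_nat -ltnS ltn_ord.
  have k0 : (0 : R) <= k%:R by [].
  suff : g (t - k%:R - 1) <= a / t + (3 * a + 16 * C) / t ^+ 2 +
      a / t ^+ 2 * k%:R + 8 * a / t ^+ 3 * k%:R ^+ 2.
    move=> /(ler_wpM2l (d0 k)); congr (_ <= _); ring.
  set y := t - k%:R - 1.
   have y4 : t / 4 <= y by rewrite /y; lra.

  have y0 : 0 < y by lra.
  have iy : y^-1 <= 4 / t.
    by rewrite -invf_div lef_pV2 ?posrE ?divr_gt0.
  have iy0 : 0 < y^-1 by rewrite invr_gt0.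
  have : g y <= a / y + C / y ^+ 2.
    by have := gb y; rewrite ler_norml => /(_ ltac:(lra)) /andP[_]; lra.
  move=> /le_trans; apply.
  (* With [h = k + 1] and [y = t - h], this is the exact expansion
     [1/y = 1/t + h/t^2 + h^2/(t^2 y)]. Summed against the slice masses, it calls for the truncated
     moments of orders 0, 1 and 2. *)
  have -> : a / y = a / t + a * (k%:R + 1) / t ^+ 2 +
     a * (k%:R + 1) ^+ 2 / t ^+ 2 * y^-1.
    by rewrite /y; field; rewrite /y in y0; lra.
  have e1 : a * (k%:R + 1) ^+ 2 / t ^+ 2 * y^-1 <=
     a * (k%:R + 1) ^+ 2 / t ^+ 2 * (4 / t).
    exact: ler_wpM2l (mulr_ge0 (mulr_ge0 a0 (sqr_ge0 _)) (ltW it2)) _ _ iy.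
  have e2 : C / y ^+ 2 <= C * (16 / t ^+ 2).
    rewrite ler_wpM2l // -exprVn.
    have -> : 16 / t ^+ 2 = (4 / t) ^+ 2 by field; lra.
    by rewrite lerXn2r // nnegrE ?divr_ge0 ?ltW.
  have e3 : a * (k%:R + 1) ^+ 2 / t ^+ 2 * (4 / t) <=
     8 * a / t ^+ 3 * k%:R ^+ 2 + a * 2 / t ^+ 2.
    have -> : a * 2 / t ^+ 2 = a * 2 * t / t ^+ 3 by field; lra.
    have -> : a * (k%:R + 1) ^+ 2 / t ^+ 2 * (4 / t) =
       (a * (4 * (k%:R + 1) ^+ 2)) / t ^+ 3 by field; lra.
    have -> : 8 * a / t ^+ 3 * k%:R ^+ 2 + a * 2 * t / t ^+ 3 =
       (a * (8 * k%:R ^+ 2 + 2 * t)) / t ^+ 3 by field; lra.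
    rewrite ler_wpM2r ?(ltW it3) // ler_wpM2l //.
    have : 0 <= (k%:R - 1 : R) ^+ 2 by apply: sqr_ge0.
    nra.
  move: e1 e2 e3; rewrite !mulrDr !mulrDl; lra.
have := le_trans u_le (ler_sum _ (fun i _ => h i)).
rewrite !big_split /= -mulr_suml sum_decrements // -!mulr_sumr.
rewrite sum_abel1 sum_abel2.
set S1 := (\sum_(k < K.+1) p k.+1 - _).
set S2 := (\sum_(k < K.+1) (2 * k%:R + 1) * p k.+1 - _).
(* The logarithm enters here, through the harmonic sum. The second moment [S2] is [O(t)], which its
   factor [t^-3] makes harmless. *)
have h1 : S1 <= b * (1 + ln t) + 3 * C.
  have := @sum_tail_le _ p b C b0 C0 pb K.
  have l : ln K.+1%:R <= ln t by rewrite ler_ln ?posrE //; lra.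
  have := mulr_ge0 (ltW K10) (p_ge0 K.+2).
  have := ler_wpM2l b0 l.
  rewrite /S1; lra.
have h2 : S2 <= t * (b + C).
  have := @sum_sqr_tail_le _ p b C C0 p_ge0 pb K.+1.
  have := mulr_ge0 (sqr_ge0 (K.+1%:R : R)) (p_ge0 K.+2).
  rewrite /S2; nra.
have c1 : 0 <= a / t + (3 * a + 16 * C) / t ^+ 2.
  by rewrite addr_ge0 // mulr_ge0 ?(ltW it0) ?(ltW it2) //; lra.
have h3 := mulr_ge0 (p_ge0 K.+2) c1.
have h4 : a / t ^+ 2 * S1 <= a / t ^+ 2 * (b * (1 + ln t) + 3 * C).
  by rewrite ler_wpM2l // mulr_ge0 // ltW.
have h5 : 8 * a / t ^+ 3 * S2 <= 8 * a * (b + C) / t ^+ 2.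
  have -> : 8 * a * (b + C) / t ^+ 2 = 8 * a / t ^+ 3 * (t * (b + C)).
    by field; lra.
  by rewrite ler_wpM2l // !mulr_ge0 // ltW.
rewrite mulrBl mul1r => hu; rewrite !lerBlDr.
rewrite [leRHS](_ : _ = a / t + (3 * a + 16 * C) / t ^+ 2 +
  a / t ^+ 2 * (b * (1 + ln t) + 3 * C) + 8 * a * (b + C) / t ^+ 2).
  by apply: (le_trans hu); apply: lerD h5; apply: lerD h4; rewrite gerBl.
field; lra.
Qed.

(** Here only slices inside [Y <= t / 2] are kept, and [X] is compared with [t - k]. The quadratic
    remainder in the expansion of [1 / (t - k)] is nonnegative and is dropped, so no second moment
    enters. *)
Lemma sliced_tail_ge (R : realType) (a b C : R) (p : nat -> R) (g : R -> R)
    (K : nat) (t u : R) :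
  0 <= a -> 0 <= b -> 0 <= C ->
  8 <= t -> K.+1%:R <= t / 2 -> t / 2 < K.+1%:R + 1 ->
  p 0%N = 1 -> (forall k, 0 <= p k) -> (forall k, p k.+1 <= p k) ->
  (forall k : nat,
    `|p k.+1 - b / (k.+1%:R : R)| <= C / pow32 (k.+1%:R : R)) ->
  (forall x, 1 <= x -> `|g x - a / x| <= C / x ^+ 2) ->
  \sum_(k < K.+1) (p k - p k.+1) * g (t - k%:R) <= u ->
  - ((4 * a * (b + C) + a * (4 * b + 4 * C) + 4 * C) / t ^+ 2) <=
    u - a / t - a * b * (ln t / t ^+ 2).
Proof.
move=> a0 b0 C0 t8 Kt tK p0 p_ge0 p_dec pb gb u_ge.
have t0 : 0 < t by lra.
have it0 : 0 < t^-1 by rewrite invr_gt0.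
have it2 : 0 < (t ^+ 2)^-1 by rewrite invr_gt0 exprn_gt0.
have d0 k : 0 <= p k - p k.+1 by rewrite subr_ge0.
have K10 : 0 < (K.+1%:R : R) by rewrite ltr0n.
have h (k : 'I_K.+1) :
   (p k - p k.+1) * (a / t - 4 * C / t ^+ 2)
   + a / t ^+ 2 * (k%:R * (p k - p k.+1)) <=
   (p k - p k.+1) * g (t - k%:R).
  have kK : (k%:R : R) <= K%:R by rewrite ler_nat -ltnS ltn_ord.
  have KK : (K.+1%:R : R) = K%:R + 1 by rewrite -addn1 natrD.
  have k0 : (0 : R) <= k%:R by [].
  suff : a / t - 4 * C / t ^+ 2 + a / t ^+ 2 * k%:R <= g (t - k%:R).
    move=> /(ler_wpM2l (d0 k)); congr (_ <= _); ring.
  set y := t - k%:R.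
  have y2 : t / 2 <= y by rewrite /y; lra.
  have y0 : 0 < y by lra.
  have iy : y^-1 <= 2 / t.
    by rewrite -invf_div lef_pV2 ?posrE ?divr_gt0.
  have iy0 : 0 < y^-1 by rewrite invr_gt0.
  have h1 : a / y - C / y ^+ 2 <= g y.
    by have := gb y; rewrite ler_norml => /(_ ltac:(lra)) /andP[]; lra.
  apply: (le_trans _ h1).
  have -> : a / y = a / t + a * k%:R / t ^+ 2 +
     a * k%:R ^+ 2 / t ^+ 2 * y^-1.
    by rewrite /y; field; rewrite /y in y0; lra.
  have e1 : 0 <= a * k%:R ^+ 2 / t ^+ 2 * y^-1.
    by rewrite !mulr_ge0 ?sqr_ge0 // ltW.
  have e2 : C / y ^+ 2 <= C * (4 / t ^+ 2).
    rewrite ler_wpM2l // -exprVn.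
    have -> : 4 / t ^+ 2 = (2 / t) ^+ 2 by field; lra.
    by rewrite lerXn2r // nnegrE ?divr_ge0 ?ltW.
  move: e1 e2; lra.
have := le_trans (ler_sum _ (fun i _ => h i)) u_ge.
rewrite big_split /= -mulr_suml sum_decrements // -!mulr_sumr sum_abel1.
set S1 := (\sum_(k < K) p k.+1 - _).
have h0 : p K.+1 <= 4 * (b + C) / t.
  apply: (le_trans (@tail_le _ p b C C0 pb K)).
  rewrite ler_pdivrMr // mulrAC ler_pdivlMr //.
  have : 0 <= b + C by lra.
  nra.
have h1 : b * ln t - (4 * b + 4 * C) <= S1.
  have := @sum_tail_ge _ p b C b0 C0 pb K.
  (* As [K + 1 >= t / 4] and [ln 4 <= 3], replacing [K + 1] by [t] costs [3 b]. The error terms of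
     [p] cost [3 C] and the boundary term [K * p K.+1] costs [b + C]. *)
  have l : ln t - 3 <= ln K.+1%:R.
    have -> : ln t = ln 4 + ln (t / 4).
      by rewrite -lnM ?posrE; [congr ln; lra|lra|lra].
    have := @ln_le_subr1 R 4 ltac:(lra).
    have : ln (t / 4) <= ln K.+1%:R by rewrite ler_ln ?posrE ?divr_gt0 //; lra.
    lra.
  have := ler_wpM2l b0 l.
  have := @tail_le _ p b C C0 pb K; rewrite ler_pdivlMr //.
  have KK : (K.+1%:R : R) = K%:R + 1 by rewrite -addn1 natrD.
  have := p_ge0 K.+1.
  rewrite KK /S1; nra.
have h4 : a / t ^+ 2 * (b * ln t - (4 * b + 4 * C)) <= a / t ^+ 2 * S1.
  by rewrite ler_wpM2l // mulr_ge0 // ltW.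
have h5 : p K.+1 * (a / t) <= 4 * a * (b + C) / t ^+ 2.
  have -> : 4 * a * (b + C) / t ^+ 2 = (4 * (b + C) / t) * (a / t).
    by field; lra.
  by rewrite ler_wpM2r // mulr_ge0 // ltW.
have h6 : 0 <= p K.+1 * (4 * C / t ^+ 2).
  by rewrite !mulr_ge0 // ltW.
rewrite mulrBl mul1r mulrBr => hu; rewrite !lerBrDr; apply: le_trans hu.
rewrite [leLHS](_ : _ = a / t - 4 * C / t ^+ 2 - 4 * a * (b + C) / t ^+ 2 +
  a / t ^+ 2 * (b * ln t - (4 * b + 4 * C))).
  by apply: lerD h4; rewrite lerD2l lerN2; move: h5 h6; lra.
field; lra.
Qed.

(** * The one-big-jump estimate *)

Section real_probability.
Context d (T : measurableType d) (R : realType) (P : probability T R).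
Implicit Types A B C : set T.

(** Real-valued, so that ordered field arithmetic applies to probabilities. On upper level sets it
    is [prob_gt] by definition. *)
Definition pr A : R := fine (P A).

Lemma prK A : measurable A -> (pr A)%:E = P A.
Proof. by move=> mA; rewrite /pr fineK // fin_num_measure. Qed.

Lemma pr_ge0 A : 0 <= pr A.
Proof. by rewrite /pr fine_ge0. Qed.

Lemma pr_setT : pr setT = 1.
Proof. by rewrite /pr probability_setT. Qed.

Lemma le_pr A B : measurable A -> measurable B -> A `<=` B -> pr A <= pr B.
Proof.
by move=> mA mB AB; rewrite -lee_fin !prK //; apply: le_measure; rewrite ?inE.
Qed.

Lemma pr_le1 A : measurable A -> pr A <= 1.
Proof. by move=> mA; rewrite -pr_setT le_pr. Qed.

Lemma prUI A B : measurable A -> measurable B -> A `&` B = set0 ->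
  pr (A `|` B) = pr A + pr B.
Proof.
move=> mA mB AB; apply: EFin_inj; rewrite EFinD !prK //.
  by rewrite measureU.
exact: measurableU.
Qed.

Lemma pr_setIDE A B : measurable A -> measurable B ->
  pr A = pr (A `&` B) + pr (A `\` B).
Proof.
move=> mA mB; rewrite -prUI ?setUIDK //; first exact: measurableI.
  exact: measurableD.
by rewrite setDE setIACA setICr setI0.
Qed.

Lemma prC A : measurable A -> pr (~` A) = 1 - pr A.
Proof.
by move=> mA; rewrite -pr_setT (pr_setIDE measurableT mA) setTI setTD addrC addKr.
Qed.

Lemma prU A B : measurable A -> measurable B ->
  pr (A `|` B) = pr A + pr B - pr (A `&` B).
Proof.
move=> mA mB; rewrite (pr_setIDE (measurableU _ _ mA mB) mA) [pr B](pr_setIDE mB mA).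
rewrite setUK setDUl setDv set0U setIC; ring.
Qed.

Lemma prU_le A B : measurable A -> measurable B ->
  pr (A `|` B) <= pr A + pr B.
Proof. by move=> mA mB; rewrite prU // gerBl pr_ge0. Qed.

Lemma prU_eq0 A B : measurable A -> measurable B ->
  pr A = 0 -> pr B = 0 -> pr (A `|` B) = 0.
Proof.
move=> mA mB A0 B0; apply/eqP; rewrite eq_le pr_ge0 andbT.
by apply: (le_trans (prU_le mA mB)); rewrite A0 B0 addr0.
Qed.

Lemma le_pr_mod0 A B N : measurable A -> measurable B -> measurable N ->
  pr N = 0 -> A `<=` B `|` N -> pr A <= pr B.
Proof.
move=> mA mB mN N0 AB; rewrite -[pr B]addr0 -N0; apply: le_trans (prU_le mB mN).
by apply: le_pr => //; exact: measurableU.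
Qed.

End real_probability.

Section levels.
Context d (T : measurableType d) (R : realType).
Implicit Types X Y : T -> R.

Lemma preimage_measurable X (A : set R) :
  measurable_fun setT X -> measurable A -> measurable (X @^-1` A).
Proof. by move=> mX mA; rewrite -[X in measurable X]setTI; exact: mX. Qed.

Lemma preimage_gt X x : X @^-1` `]x, +oo[ = [set w | x < X w].
Proof. by apply/seteqP; split => w /=; rewrite in_itv /= andbT. Qed.

Lemma preimage_le X x : X @^-1` `]-oo, x] = [set w | X w <= x].
Proof. by apply/seteqP; split => w /=; rewrite in_itv. Qed.

Lemma measurable_gt X x : measurable_fun setT X -> measurable [set w | x < X w].
Proof. by rewrite -preimage_gt => mX; exact: preimage_measurable. Qed.

Lemma measurable_le X x : measurable_fun setT X -> measurable [set w | X w <= x].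
Proof. by rewrite -preimage_le => mX; exact: preimage_measurable. Qed.

Lemma setC_gt X x : ~` [set w | x < X w] = [set w | X w <= x].
Proof. 
by apply/seteqP; split => w /=; [move/negP|]; rewrite leNgt => // /negP.
Qed.

End levels.

Section big_jump.
Context d (T : measurableType d) (R : realType) (P : probability T R).
Context (X Y : T -> R).
Hypotheses (mX : measurable_fun setT X) (mY : measurable_fun setT Y).
Hypothesis XY : forall x y,
  pr P ([set w | x < X w] `&` [set w | Y w <= y]) =
  pr P [set w | x < X w] * pr P [set w | Y w <= y].
Hypothesis Y_gt0 : pr P [set w | Y w <= 0] = 0.

Let p (k : nat) : R := pr P [set w | k%:R < Y w].
Let g x := pr P [set w | x < X w].

(** The cap [Y <= t / 2] forces [X > t / 2]. This makes the events for different jumping variables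
    disjoint up to probability [O(t^-2)]. *)
Definition big_jump (t : R) : set T := [set w | t < X w + Y w] `&` [set w | Y w <= t / 2].

Lemma measurable_big_jump t : measurable (big_jump t).
Proof.
apply: measurableI; last exact: measurable_le.
by apply: measurable_gt; exact: measurable_funD.
Qed.

Let pE k : pr P [set w | Y w <= k%:R] = 1 - p k.
Proof. by rewrite -setC_gt prC //; exact: measurable_gt. Qed.

Let slice x (k : nat) := [set w | x < X w] `&`
  ([set w | Y w <= k.+1%:R] `\` [set w | Y w <= k%:R]).

Let measurable_slice x k : measurable (slice x k).
Proof.
apply: measurableI; first exact: measurable_gt.
by apply: measurableD; exact: measurable_le.
Qed.

Let pr_slice x k : pr P (slice x k) = (p k - p k.+1) * g x.
Proof.
have mXx := @measurable_gt _ _ _ X x mX.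
have mYk (j : nat) := @measurable_le _ _ _ Y j%:R mY.
have := pr_setIDE P (measurableI _ _ mXx (mYk k.+1)) (mYk k).
rewrite XY -setIA.
have -> : [set w | Y w <= k.+1%:R] `&` [set w | Y w <= k%:R] = [set w | Y w <= k%:R].
  by apply: setIidr => w /= /le_trans; apply; rewrite ler_nat.
by rewrite XY !pE -setIDA -/(slice _ _) -/(g x) => h; lra.
Qed.

(** On the slice [k < Y <= k + 1], exceeding [t] forces [X > t - k - 1], whereas [X > t - k] is
    enough to exceed [t]; the latter gives [big_jump_ge]. *)
Let big_jump_le (t : R) (n : nat) :
  pr P (big_jump t `&` [set w | Y w <= n%:R]) <=
  \sum_(k < n) (p k - p k.+1) * g (t - k%:R - 1).
Proof.
have mB := measurable_big_jump t.
have mYk (j : nat) := @measurable_le _ _ _ Y j%:R mY.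
elim: n => [|n IH].
  rewrite big_ord0 -Y_gt0; apply: le_pr; [exact: measurableI|exact: measurable_le|].
  by move=> w [].
rewrite big_ord_recr /=; apply: (le_trans _ (lerD IH (lexx _))).
rewrite -pr_slice.
have mBn : measurable (big_jump t `&` [set w | Y w <= n%:R]) by exact: measurableI.
apply: le_trans (prU_le _ mBn (measurable_slice _ _)).
apply: le_pr; [exact: measurableI|exact: measurableU|].
move=> w [[/= tXY Yt] Yn]; have [Yn'|nY] := leP (Y w) n%:R; first by left.
right; split; last by split => //=; apply/negP; rewrite -ltNge.
by move: Yn => /=; rewrite -natr1; lra.
Qed.

Let big_jump_ge (t : R) (n : nat) : n%:R <= t / 2 ->
  \sum_(k < n) (p k - p k.+1) * g (t - k%:R) <=
  pr P (big_jump t `&` [set w | Y w <= n%:R]).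
Proof.
have mB := measurable_big_jump t.
have mYk (j : nat) := @measurable_le _ _ _ Y j%:R mY.
elim: n => [|n IH] nt; first by rewrite big_ord0 pr_ge0.
rewrite big_ord_recr /=.
have nt' : (n%:R : R) <= t / 2 by apply: le_trans nt; rewrite ler_nat.
apply: (le_trans (lerD (IH nt') (lexx _))).
have mBn : measurable (big_jump t `&` [set w | Y w <= n%:R]) by exact: measurableI.
rewrite -pr_slice -prUI //.
- apply: le_pr; [exact: measurableU|exact: measurableI|].
  move=> w [[[/= tXY Yt] Yn]|[/= tX [Yn1 /negP]]].
    by split; [|apply: (le_trans Yn); rewrite ler_nat].
  rewrite -ltNge => Yn; split => //; split => /=; first lra.
  exact: le_trans Yn1 nt.
- by rewrite -subset0 => w [[_ Yn] [_ [_ nYn]]]; exact: nYn.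
Qed.

(** A weaker error is allowed for [Y] than for [X]: the tail of [X] is evaluated at arguments of
    order [t], while that of [Y] enters only through truncated moments. *)
Lemma big_jump_tail (a b C : R) :
  0 <= a -> 0 <= b -> 0 <= C ->
  (forall x, 1 <= x -> `|g x - a / x| <= C / x ^+ 2) ->
  (forall y, 1 <= y -> `|pr P [set w | y < Y w] - b / y| <= C / pow32 y) ->
  exists C' : R, forall t : R, 8 <= t ->
    `|pr P (big_jump t) - a / t - a * b * (ln t / t ^+ 2)| <= C' / t ^+ 2.
Proof.
move=> a0 b0 C0 gb pb.
have mYk (j : nat) := @measurable_le _ _ _ Y j%:R mY.
set C1 := a * (b + 3 * C) + 8 * a * (b + C) + 3 * a + 16 * C.
set C2 := 4 * a * (b + C) + a * (4 * b + 4 * C) + 4 * C.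
have C10 : 0 <= C1 by rewrite /C1; nra.
have C20 : 0 <= C2 by rewrite /C2; nra.
exists (C1 + C2) => t t8.
have it2 : 0 < (t ^+ 2)^-1 by rewrite invr_gt0 exprn_gt0 //; lra.
have mB := measurable_big_jump t.
have p0 : p 0%N = 1 by have := pE 0; rewrite Y_gt0; lra.
have p_ge0 k : 0 <= p k by exact: pr_ge0.
have p_dec k : p k.+1 <= p k.
  apply: le_pr; [exact: measurable_gt|exact: measurable_gt|].
  by move=> w /=; apply: le_lt_trans; rewrite ler_nat.
have pb' (k : nat) : `|p k.+1 - b / (k.+1%:R : R)| <= C / pow32 (k.+1%:R : R).
  by apply: pb; rewrite ler1n.
have [K Kt tK] : exists2 K : nat, K%:R <= t / 2 & t / 2 < K.+1%:R.
  by exists (Num.truncn (t / 2)); have /truncn_itv/andP[] : 0 <= t / 2 by lra.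
(* Since [t / 2 >= 4], its integer part is a successor, from now on [K.+1]. Slices with index below
   [K.+2] cover [Y <= t / 2], and those with index below [K.+1] stay within it. *)
case: K => [|K] in Kt tK *; first by move: tK; lra.
rewrite -(natr1 K.+1) in tK.
have h1 := @sliced_tail_le _ a b C p g K t (pr P (big_jump t)) a0 b0 C0 t8 Kt tK
  p0 p_ge0 p_dec pb' gb.
have h2 := @sliced_tail_ge _ a b C p g K t (pr P (big_jump t)) a0 b0 C0 t8 Kt tK
  p0 p_ge0 p_dec pb' gb.
have {}h1 : _ := h1 (le_trans _ (big_jump_le t K.+2)).
have {}h2 : _ := h2 (le_trans (big_jump_ge Kt) _).
rewrite ler_norml mulrDl; apply/andP; split.
  have := mulr_ge0 C10 (ltW it2).
  suff : - (C2 / t ^+ 2) <= pr P (big_jump t) - a / t - a * b * (ln t / t ^+ 2) by lra.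
  by apply: h2; apply: le_pr => //; exact: measurableI.
have := mulr_ge0 C20 (ltW it2).
suff : pr P (big_jump t) - a / t - a * b * (ln t / t ^+ 2) <= C1 / t ^+ 2 by lra.
apply: h1; apply: le_pr => //; first exact: measurableI.
move=> w Bw; split => //; case: Bw => _ /= Yt.
by apply: (le_trans Yt); rewrite -(natr1 K.+1); move: tK; lra.
Qed.

End big_jump.

(** Explicit constants are kept instead of Landau notation because the expansions are later used at
    shifted, rescaled and quantile arguments. *)
Definition tail_expansion (R : realType) (f : R -> R) (a s : R) : Prop :=
  exists C T : R, forall t, T <= t ->
    `|f t - a / t - s * (ln t / t ^+ 2)| <= C / t ^+ 2.

(** * Independence of two and three variables *)

Section independence.
Context d (T : measurableType d) (R : realType) (P : probability T R).
Implicit Types X Y Z : T -> R.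

(** Stated for plain functions, so that composites and sums need no random variable structure. *)
Definition indep2 X Y : Prop := forall A B : set R,
  measurable A -> measurable B ->
  pr P (X @^-1` A `&` Y @^-1` B) = pr P (X @^-1` A) * pr P (Y @^-1` B).

Definition indep3 X Y Z : Prop := forall A B C : set R,
  measurable A -> measurable B -> measurable C ->
  pr P (X @^-1` A `&` Y @^-1` B `&` Z @^-1` C) =
  pr P (X @^-1` A) * pr P (Y @^-1` B) * pr P (Z @^-1` C).

Lemma indep3_swap X Y Z : indep3 X Y Z -> indep3 Y X Z.
Proof.
move=> XYZ A B C mA mB mC.
by rewrite (setIC (Y @^-1` A)) XYZ // (mulrC (pr P (X @^-1` B))).
Qed.

Lemma indep3_rot X Y Z : indep3 X Y Z -> indep3 Y Z X.
Proof. by move=> XYZ A B C mA mB mC; rewrite setIC setIA XYZ // -mulrA mulrC. Qed.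

Lemma indep3_indep2 X Y Z : indep3 X Y Z -> indep2 X Y.
Proof.
move=> XYZ A B mA mB; have := XYZ A B setT mA mB measurableT.
by rewrite preimage_setT setIT pr_setT mulr1.
Qed.

Lemma indep2_comp X Y (f g : R -> R) :
  measurable_fun setT f -> measurable_fun setT g ->
  indep2 X Y -> indep2 (f \o X) (g \o Y).
Proof.
move=> mf mg XY A B mA mB.
exact: XY (preimage_measurable mf mA) (preimage_measurable mg mB).
Qed.

Lemma indep3_comp X Y Z (f : R -> R) : measurable_fun setT f ->
  indep3 X Y Z -> indep3 (f \o X) (f \o Y) (f \o Z).
Proof.
move=> mf XYZ A B C mA mB mC.
exact: XYZ (preimage_measurable mf mA) (preimage_measurable mf mB)
  (preimage_measurable mf mC).
Qed.

Lemma indep2_gt X Y x y : indep2 X Y ->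
  pr P ([set w | x < X w] `&` [set w | y < Y w]) =
  pr P [set w | x < X w] * pr P [set w | y < Y w].
Proof. by move=> XY; rewrite -!preimage_gt XY. Qed.

Lemma indep2_gt_le X Y x y : indep2 X Y ->
  pr P ([set w | x < X w] `&` [set w | Y w <= y]) =
  pr P [set w | x < X w] * pr P [set w | Y w <= y].
Proof. by move=> XY; rewrite -preimage_gt -preimage_le XY. Qed.

Lemma indep2_le X Y x y : indep2 X Y ->
  pr P ([set w | X w <= x] `&` [set w | Y w <= y]) =
  pr P [set w | X w <= x] * pr P [set w | Y w <= y].
Proof. by move=> XY; rewrite -(preimage_le X) -(preimage_le Y) XY. Qed.

Lemma indep3_gt_le X Y Z x y z : indep3 X Y Z ->
  pr P ([set w | x < X w] `&` [set w | Y w <= y] `&` [set w | Z w <= z]) =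
  pr P [set w | x < X w] * pr P [set w | Y w <= y] * pr P [set w | Z w <= z].
Proof.
by move=> XYZ; rewrite -(preimage_gt X) -(preimage_le Y) -(preimage_le Z) XYZ.
Qed.

End independence.

(** * Splitting a tail event according to the jumping variable *)

Section three_jumps.
Context d (T : measurableType d) (R : realType) (P : probability T R).
Context (Z1 Z2 Z3 : T -> R).

Definition two_large (t : R) : set T :=
  [set w | t < Z1 w] `&` [set w | t < Z2 w] `|`
  [set w | t < Z1 w] `&` [set w | t < Z3 w] `|`
  [set w | t < Z2 w] `&` [set w | t < Z3 w].

Hypotheses (mZ1 : measurable_fun setT Z1) (mZ2 : measurable_fun setT Z2).
Hypotheses (mZ3 : measurable_fun setT Z3) (Z123 : indep3 P Z1 Z2 Z3).
Hypothesis Z1_tail : forall z, 1 <= z -> pr P [set w | z < Z1 w] <= z^-1.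
Hypothesis Z2_tail : forall z, 1 <= z -> pr P [set w | z < Z2 w] <= z^-1.
Hypothesis Z3_tail : forall z, 1 <= z -> pr P [set w | z < Z3 w] <= z^-1.

Lemma measurable_two_large t : measurable (two_large t).
Proof.
by apply: measurableU; [apply: measurableU|]; apply: measurableI; exact: measurable_gt.
Qed.

(** By independence each of the three pairs contributes at most [(8 / t)^2]. *)
Lemma pr_two_large (t : R) : 8 <= t -> pr P (two_large (t / 8)) <= 192 / t ^+ 2.
Proof.
move=> t8; have t1 : 1 <= t / 8 by lra.
have h a b : a <= (t / 8)^-1 -> b <= (t / 8)^-1 -> 0 <= a -> 0 <= b ->
    a * b <= 64 / t ^+ 2.
  move=> ah bh a0 b0; have -> : 64 / t ^+ 2 = (t / 8)^-1 * (t / 8)^-1.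
    by field; lra.
  exact: ler_pM.
have m z := @measurable_gt _ _ _ Z1 z mZ1.
have m2 z := @measurable_gt _ _ _ Z2 z mZ2.
have m3 z := @measurable_gt _ _ _ Z3 z mZ3.
have i12 := indep3_indep2 Z123.
have i13 := indep3_indep2 (indep3_swap (indep3_rot (indep3_rot Z123))).
have i23 := indep3_indep2 (indep3_rot Z123).
have h1 := Z1_tail t1; have h2 := Z2_tail t1; have h3 := Z3_tail t1.
have m12 := measurableI _ _ (m (t / 8)) (m2 (t / 8)).
have m13 := measurableI _ _ (m (t / 8)) (m3 (t / 8)).
have m23 := measurableI _ _ (m2 (t / 8)) (m3 (t / 8)).
have := prU_le P m12 m13; have := prU_le P (measurableU _ _ m12 m13) m23.
rewrite !indep2_gt //.
have := h _ _ h1 h2 (pr_ge0 _ _) (pr_ge0 _ _).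
have := h _ _ h1 h3 (pr_ge0 _ _) (pr_ge0 _ _).
have := h _ _ h2 h3 (pr_ge0 _ _) (pr_ge0 _ _).
rewrite /two_large; lra.
Qed.

(** Inclusion-exclusion: both the overlaps of the [A_i] and the part of [E] they miss lie in
    [two_large (t / 8)]. The three overlaps account for [3 * 192]. *)
Lemma tail_expansion_of_three (E A1 A2 A3 : R -> set T) (a1 a2 a3 s1 s2 s3 : R) :
  (forall t, measurable (E t)) -> (forall t, measurable (A1 t)) ->
  (forall t, measurable (A2 t)) -> (forall t, measurable (A3 t)) ->
  (forall t, 0 < t -> E t `<=` A1 t `|` A2 t `|` A3 t `|` two_large (t / 8)) ->
  (forall t, 0 < t -> A1 t `|` A2 t `|` A3 t `<=` E t) ->
  (forall t, 0 < t -> A1 t `&` A2 t `<=` two_large (t / 8)) ->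
  (forall t, 0 < t -> A1 t `&` A3 t `<=` two_large (t / 8)) ->
  (forall t, 0 < t -> A2 t `&` A3 t `<=` two_large (t / 8)) ->
  tail_expansion (fun t => pr P (A1 t)) a1 s1 ->
  tail_expansion (fun t => pr P (A2 t)) a2 s2 ->
  tail_expansion (fun t => pr P (A3 t)) a3 s3 ->
  tail_expansion (fun t => pr P (E t)) (a1 + a2 + a3) (s1 + s2 + s3).
Proof.
move=> mE m1 m2 m3 EA AE A12 A13 A23 [C1 [T1 h1]] [C2 [T2 h2]] [C3 [T3 h3]].
exists (C1 + C2 + C3 + 3 * 192), (Num.max 8 (Num.max T1 (Num.max T2 T3))) => t.
rewrite !ge_max => /and4P[t8 /h1{}h1 /h2{}h2 /h3{}h3].
have t0 : 0 < t by lra.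
have mB := measurable_two_large (t / 8).
have hB := pr_two_large t8.
have m12 := measurableU _ _ (m1 t) (m2 t).
have m123 := measurableU _ _ m12 (m3 t).
have e1 : pr P (E t) <=
    pr P (A1 t) + pr P (A2 t) + pr P (A3 t) + pr P (two_large (t / 8)).
  apply: le_trans (le_pr P (mE t) (measurableU _ _ m123 mB) (EA t t0)) _.
  have := prU_le P m123 mB; have := prU_le P m12 (m3 t).
  have := prU_le P (m1 t) (m2 t); lra.
have e2 := le_pr P m123 (mE t) (AE t t0).
have := prU P m12 (m3 t); rewrite setIUl => e3.
have := prU P (m1 t) (m2 t) => e4.
have i12 := measurableI _ _ (m1 t) (m2 t).
have i13 := measurableI _ _ (m1 t) (m3 t).
have i23 := measurableI _ _ (m2 t) (m3 t).
have e5 := prU_le P i13 i23.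
have e12 := le_pr P i12 mB (A12 t t0).
have e13 := le_pr P i13 mB (A13 t t0).
have e23 := le_pr P i23 mB (A23 t t0).
have b0 := pr_ge0 P (two_large (t / 8)).
move: h1 h2 h3; rewrite !ler_norml !mulrDl => /andP[h1 h1'] /andP[h2 h2'] /andP[h3 h3'].
by apply/andP; split; lra.
Qed.

End three_jumps.

(** * Shared exponentials *)

(** With [s = sqrt (1 - y)] the error is exactly [(1 - s)^2 / 2], and [1 - s <= 1 - s^2 = y]. *)
Lemma subr1_sqrt_approx (R : realType) (y : R) : 0 <= y <= 1 ->
  `|1 - Num.sqrt (1 - y) - y / 2| <= y ^+ 2 / 2.
Proof.
move=> /andP[y0 y1]; set s := Num.sqrt (1 - y).
have s0 : 0 <= s by exact: sqrtr_ge0.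
have s2 : s ^+ 2 = 1 - y by rewrite sqr_sqrtr; lra.
have yE : y = 1 - s ^+ 2 by lra.
have s1 : s <= 1 by nra.
have -> : 1 - s - y / 2 = (1 - s) ^+ 2 / 2 by rewrite yE; field.
rewrite ger0_norm ?divr_ge0 ?sqr_ge0 // ler_pM2r ?invr_gt0 //.
rewrite lerXn2r ?nnegrE //; nra.
Qed.

Lemma max_le_setI (T : Type) (R : realType) (X Y : T -> R) (y : R) :
  [set w | Num.max (X w) (Y w) <= y] =
  [set w | X w <= y] `&` [set w | Y w <= y].
Proof.
apply/seteqP; split => w /=; first by rewrite ge_max => /andP[].
by case=> Xy Yy; rewrite ge_max Xy.
Qed.

Lemma gt_pscale (T : Type) (R : realType) (X : T -> R) (a x : R) : 0 < a ->
  [set w | x < a * X w] = [set w | x / a < X w].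
Proof. by move=> a0; apply/seteqP; split => w /=; rewrite ltr_pdivrMr // mulrC. Qed.

Lemma le_pscale (T : Type) (R : realType) (X : T -> R) (a x : R) : 0 < a ->
  [set w | a * X w <= x] = [set w | X w <= x / a].
Proof. by move=> a0; apply/seteqP; split => w /=; rewrite ler_pdivlMr // mulrC. Qed.

Lemma ge1_divr (R : realType) (a x : R) : 0 < a -> a <= 1 -> 1 <= x -> 1 <= x / a.
Proof. by move=> a0 a1 x1; rewrite ler_pdivlMr // mul1r (le_trans a1). Qed.

Lemma large_factor (R : realType) (a x t : R) :
  0 < a -> a <= 1 -> 0 < t -> t / 2 < a * x -> t / 8 < x.
Proof. by move=> a0 a1 t0 h; nra. Qed.

Section shared.
Context d (T : measurableType d) (R : realType) (P : probability T R).

(** The law of [1 / (1 - exp(-2 E))] for [E] standard exponential; to first order the tail is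
    [1 / (2 x)]. *)
Definition sqrt_tail (Z : T -> R) : Prop :=
  forall x, 1 <= x -> pr P [set w | x < Z w] = 1 - Num.sqrt (1 - x^-1).

Lemma sqrt_tail_le (Z : T -> R) : sqrt_tail Z ->
  forall x, 1 <= x -> pr P [set w | x < Z w] <= x^-1.
Proof.
move=> hZ x x1; rewrite hZ //.
have x0 : 0 < x by lra.
have i0 : 0 < x^-1 by rewrite invr_gt0.
have i1 : x^-1 <= 1 by rewrite invf_le1.
set s := Num.sqrt _.
have s0 : 0 <= s by exact: sqrtr_ge0.
have s2 : s ^+ 2 = 1 - x^-1 by rewrite sqr_sqrtr; lra.
nra.
Qed.

(** Distribution functions multiply, and the square of [sqrt (1 - 1/x)] is the distribution function
    of the reciprocal of a uniform variable. *)
Lemma max_sqrt_tail (Z Z' : T -> R) x :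
  measurable_fun setT Z -> measurable_fun setT Z' -> indep2 P Z Z' ->
  sqrt_tail Z -> sqrt_tail Z' -> 1 <= x ->
  pr P [set w | x < Num.max (Z w) (Z' w)] = x^-1.
Proof.
move=> mZ mZ' ZZ' hZ hZ' x1.
have mM : measurable_fun setT (fun w => Num.max (Z w) (Z' w)) by exact: measurable_maxr.
have := prC P (measurable_gt x mM); rewrite setC_gt max_le_setI.
rewrite indep2_le // -(setC_gt Z) -(setC_gt Z') !prC; [|exact: measurable_gt..].
rewrite hZ // hZ' // !subKr -expr2 sqr_sqrtr; first lra.
by rewrite subr_ge0 invf_le1 //; lra.
Qed.

(** The jumping term has tail [a / (2 x) + O(x^-2)] by [subr1_sqrt_approx]; the other term has tail
    exactly [b / y]. *)
Lemma shared_jump_tail (Z Z' Z'' : T -> R) (a b : R) :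
  0 < a -> a <= 1 -> 0 < b -> b <= 1 ->
  measurable_fun setT Z -> measurable_fun setT Z' -> measurable_fun setT Z'' ->
  indep3 P Z Z' Z'' -> sqrt_tail Z -> sqrt_tail Z' -> sqrt_tail Z'' ->
  tail_expansion (fun t => pr P (big_jump (fun w => a * Z w)
    (fun w => b * Num.max (Z' w) (Z'' w)) t)) (a / 2) (a / 2 * b).
Proof.
move=> a0 a1 b0 b1 mZ mZ' mZ'' ZZZ hZ hZ' hZ''.
have mM : measurable_fun setT (fun w => Num.max (Z' w) (Z'' w)) by exact: measurable_maxr.
have mX : measurable_fun setT (fun w => a * Z w) by exact: measurable_funM.
have mY : measurable_fun setT (fun w => b * Num.max (Z' w) (Z'' w)).
  exact: measurable_funM.
have ZZ := indep3_indep2 (indep3_rot ZZZ).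
have XY x y : pr P ([set w | x < a * Z w] `&`
      [set w | b * Num.max (Z' w) (Z'' w) <= y]) =
    pr P [set w | x < a * Z w] * pr P [set w | b * Num.max (Z' w) (Z'' w) <= y].
  rewrite gt_pscale // le_pscale // max_le_setI setIA.
  by rewrite indep3_gt_le // indep2_le // mulrA.
have tY y : 1 <= y -> pr P [set w | y < b * Num.max (Z' w) (Z'' w)] = b / y.
  move=> y1; rewrite gt_pscale // max_sqrt_tail ?ge1_divr // invf_div //.
(* The tail of the maximum equals 1 at 1, so the second term exceeds [b] almost surely. *)
have Y0 : pr P [set w | b * Num.max (Z' w) (Z'' w) <= 0] = 0.
  apply/eqP; rewrite eq_le pr_ge0 andbT.
  have := prC P (measurable_gt b mY); rewrite setC_gt gt_pscale // divff ?gt_eqF //.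
  rewrite max_sqrt_tail // invr1 subrr => Y1; rewrite -[leRHS]Y1.
  apply: le_pr; [exact: measurable_le|exact: measurable_le|].
  by move=> w /= /le_trans; apply; exact: ltW.
have [] := @big_jump_tail _ _ _ P _ _ mX mY XY Y0 (a / 2) b 1.
- by rewrite divr_ge0 // ltW.
- exact: ltW.
- exact: ler01.
- move=> x x1; rewrite gt_pscale // hZ ?ge1_divr // invf_div.
  have x0 : 0 < x by lra.
  have -> : a / 2 / x = a / x / 2 by field; lra.
  apply: le_trans (subr1_sqrt_approx _) _.
    by apply/andP; split; [exact: divr_ge0 (ltW a0) (ltW x0)|
      rewrite ler_pdivrMr // mul1r (le_trans a1)].
  rewrite expr_div_n mulrAC ler_pM2r ?invr_gt0 ?exprn_gt0 //; nra.
- move=> y y1; rewrite tY // subrr normr0 divr_ge0 ?ler01 //.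
  by apply/ltW/pow32_gt0; lra.
by move=> C h; exists C, 8 => t /h.
Qed.

(** Here [Z1], [Z2], [Z3] stand for [Z_12], [Z_13], [Z_23]. Each occurs in two of the maxima, so it
    jumps with the sum of two weights, and the remaining maximum keeps the third. *)
Lemma shared_tail (Z1 Z2 Z3 : T -> R) (w1 w2 w3 : R) :
  0 < w1 -> 0 < w2 -> 0 < w3 -> w1 + w2 + w3 = 1 ->
  measurable_fun setT Z1 -> measurable_fun setT Z2 -> measurable_fun setT Z3 ->
  indep3 P Z1 Z2 Z3 -> sqrt_tail Z1 -> sqrt_tail Z2 -> sqrt_tail Z3 ->
  tail_expansion (fun t => pr P [set w | t < w1 * Num.max (Z1 w) (Z2 w) +
      w2 * Num.max (Z1 w) (Z3 w) + w3 * Num.max (Z2 w) (Z3 w)])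
    1 (w1 * w2 + w1 * w3 + w2 * w3).
Proof.
move=> w10 w20 w30 ws m1 m2 m3 Z123 h1 h2 h3.
pose E (t : R) := [set w | t < w1 * Num.max (Z1 w) (Z2 w) +
  w2 * Num.max (Z1 w) (Z3 w) + w3 * Num.max (Z2 w) (Z3 w)].
pose A1 := big_jump (fun w => (w1 + w2) * Z1 w) (fun w => w3 * Num.max (Z2 w) (Z3 w)).
pose A2 := big_jump (fun w => (w1 + w3) * Z2 w) (fun w => w2 * Num.max (Z1 w) (Z3 w)).
pose A3 := big_jump (fun w => (w2 + w3) * Z3 w) (fun w => w1 * Num.max (Z1 w) (Z2 w)).
have mM (X Y : T -> R) : measurable_fun setT X -> measurable_fun setT Y ->
  measurable_fun setT (fun w => Num.max (X w) (Y w)) by exact: measurable_maxr.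
have mS (X : T -> R) a : measurable_fun setT X -> measurable_fun setT (fun w => a * X w).
  by move=> ?; exact: measurable_funM.
have t1 : tail_expansion (fun t => pr P (A1 t)) ((w1 + w2) / 2) ((w1 + w2) / 2 * w3).
  by apply: shared_jump_tail => //; lra.
have t2 : tail_expansion (fun t => pr P (A2 t)) ((w1 + w3) / 2) ((w1 + w3) / 2 * w2).
  by apply: shared_jump_tail => //; [lra|lra|lra|exact: indep3_swap].
have t3 : tail_expansion (fun t => pr P (A3 t)) ((w2 + w3) / 2) ((w2 + w3) / 2 * w1).
  by apply: shared_jump_tail => //; [lra|lra|lra|exact: indep3_rot (indep3_rot _)].
have -> : 1 = (w1 + w2) / 2 + (w1 + w3) / 2 + (w2 + w3) / 2 :> R by lra.
have -> : w1 * w2 + w1 * w3 + w2 * w3 =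
  (w1 + w2) / 2 * w3 + (w1 + w3) / 2 * w2 + (w2 + w3) / 2 * w1 by field.
apply: (@tail_expansion_of_three _ _ _ P _ _ _ m1 m2 m3 Z123
  (sqrt_tail_le h1) (sqrt_tail_le h2) (sqrt_tail_le h3)
  E A1 A2 A3 _ _ _ _ _ _ _ _ _ _ _ _ _ _ _ t1 t2 t3).
- move=> t; apply: measurable_gt; apply: measurable_funD; last by exact/mS/mM.
  by apply: measurable_funD; exact/mS/mM.
- by move=> t; apply: measurable_big_jump; [exact: mS|exact/mS/mM].
- by move=> t; apply: measurable_big_jump; [exact: mS|exact/mS/mM].
- by move=> t; apply: measurable_big_jump; [exact: mS|exact/mS/mM].
- move=> t t0 w; rewrite /E /A1 /A2 /A3 /big_jump /two_large /=.
  have lf a x : t / 2 < a * x -> 0 < a -> a <= 1 -> t / 8 < x.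
    by move=> h a0 a1; exact: large_factor a0 a1 t0 h.
  (* Six consistent orderings remain. The largest variable makes the jump if the remaining term is
     at most [t / 2]; otherwise the second largest, and with it the largest, exceeds [t / 8]. *)
  case: (leP (Z2 w) (Z1 w)) => h21; case: (leP (Z3 w) (Z1 w)) => h31;
    case: (leP (Z3 w) (Z2 w)) => h32 tE; try lra.
  + have [le|/lf gt] := leP (w3 * Z2 w) (t / 2).
      by left; left; left; split => //; lra.
    by right; left; left; split; move: (gt w30 ltac:(lra)); lra.
  + have [le|/lf gt] := leP (w3 * Z3 w) (t / 2).
      by left; left; left; split => //; lra.
    by right; left; right; split; move: (gt w30 ltac:(lra)); lra.
  + have [le|/lf gt] := leP (w1 * Z1 w) (t / 2).
      by left; right; split => //; lra.
    by right; left; right; split; move: (gt w10 ltac:(lra)); lra.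
  + have [le|/lf gt] := leP (w2 * Z1 w) (t / 2).
      by left; left; right; split => //; lra.
    by right; left; left; split; move: (gt w20 ltac:(lra)); lra.
  + have [le|/lf gt] := leP (w2 * Z3 w) (t / 2).
      by left; left; right; split => //; lra.
    by right; right; split; move: (gt w20 ltac:(lra)); lra.
  + have [le|/lf gt] := leP (w1 * Z2 w) (t / 2).
      by left; right; split => //; lra.
    by right; right; split; move: (gt w10 ltac:(lra)); lra.
- move=> t t0 w; rewrite /E /A1 /A2 /A3 /big_jump /=.
  have le_w (a x y : R) (a0 : 0 < a) : a * x <= a * Num.max x y.
    by rewrite ler_pM2l // le_max lexx.
  have le_w' (a x y : R) (a0 : 0 < a) : a * y <= a * Num.max x y.
    by rewrite ler_pM2l // le_max lexx orbT.
  have := le_w _ (Z1 w) (Z2 w) w10; have := le_w _ (Z1 w) (Z3 w) w20.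
  have := le_w _ (Z2 w) (Z3 w) w30; have := le_w' _ (Z1 w) (Z2 w) w10.
  have := le_w' _ (Z1 w) (Z3 w) w20; have := le_w' _ (Z2 w) (Z3 w) w30.
  move: (Num.max (Z1 w) (Z2 w)) (Num.max (Z1 w) (Z3 w)) (Num.max (Z2 w) (Z3 w)).
  by move=> x y z e1 e2 e3 e4 e5 e6 [[]|] [h _]; lra.
- move=> t t0 w [[/= h1' h2'] [/= h3' h4']]; left; left; split.
    by apply: (@large_factor _ (w1 + w2)); lra.
  by apply: (@large_factor _ (w1 + w3)); lra.
- move=> t t0 w [[/= h1' h2'] [/= h3' h4']]; left; right; split.
    by apply: (@large_factor _ (w1 + w2)); lra.
  by apply: (@large_factor _ (w2 + w3)); lra.
- move=> t t0 w [[/= h1' h2'] [/= h3' h4']]; right; split.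
    by apply: (@large_factor _ (w1 + w3)); lra.
  by apply: (@large_factor _ (w2 + w3)); lra.
Qed.

End shared.

(** * Independent uniforms *)

Section joint_law.
Context d (T : measurableType d) (R : realType) (P : probability T R).
Implicit Types X Y Z : T -> R.

(** For fixed [C], both sides are finite measures in [B], here [m1] and [m2]. They agree on
    rectangles, which are closed under intersection and generate the product sigma-algebra. *)
Lemma indep3_pair X Y Z (B : set (R * R)) (C : set R) :
  measurable_fun setT X -> measurable_fun setT Y -> measurable_fun setT Z ->
  indep3 P X Y Z -> measurable B -> measurable C ->
  pr P ([set w | B (X w, Y w)] `&` Z @^-1` C) =
  pr P [set w | B (X w, Y w)] * pr P (Z @^-1` C).
Proof.
move=> mX mY mZ XYZ mB mC.
have mZC := preimage_measurable mZ mC.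
have mXY : measurable_fun setT (fun w => (X w, Y w)) by exact: measurable_fun_pair.
have mXYD (D : set (R * R)) : measurable D -> measurable [set w | D (X w, Y w)].
  by move=> mD; rewrite -[X in measurable X]setTI; exact: mXY.
pose m1 : {measure set (R * R) -> \bar R} :=
  measure_function_pushforward__canonical__measure_function_Measure
    (mrestr P mZC) mXY.
pose m2 : {measure set (R * R) -> \bar R} :=
  mscale (NngNum (pr_ge0 P (Z @^-1` C)))
    (measure_function_pushforward__canonical__measure_function_Measure P mXY).
have m12 : m1 B = m2 B.
  apply: (measure_unique [set A `*` B | A in measurable & B in measurable]
    (fun=> setT)) => //.
  - exact: measurable_prod_measurableType.
  - move=> _ _ [A1 mA1 [B1 mB1 <-]] [A2 mA2 [B2 mB2 <-]].
    exists (A1 `&` A2); first exact: measurableI.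
    by exists (B1 `&` B2); [exact: measurableI|rewrite setXI].
  - by move=> _; exists setT => //; exists setT => //; rewrite setXTT.
  - by rewrite bigcup_const.
  - move=> _ [A mA [D mD <-]].
    rewrite /m1 /m2 /= /mscale /mrestr /pushforward /=.
    have mA' := preimage_measurable mX mA; have mD' := preimage_measurable mY mD.
    rewrite -[X in P (X `&` _)]/(X @^-1` A `&` Y @^-1` D).
    rewrite -[X in (_ * P X)%E]/(X @^-1` A `&` Y @^-1` D).
    rewrite -!prK; [|exact: measurableI|by apply: measurableI => //; exact: measurableI].
    by rewrite XYZ // (indep3_indep2 XYZ) // -EFinM mulrC.
  - move=> _; rewrite /m1 /= /mrestr /pushforward /=.
    apply: (@le_lt_trans _ _ 1%E); last exact: ltry.
    by apply: probability_le1; apply: measurableI => //; exact: (mXYD _ measurableT).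
have e : P ([set w | B (X w, Y w)] `&` Z @^-1` C) =
  ((pr P (Z @^-1` C))%:E * P [set w | B (X w, Y w)])%E by exact: m12.
apply: EFin_inj; rewrite prK; last by apply: measurableI => //; exact: mXYD.
by rewrite e EFinM muleC (prK _ (mXYD _ mB)).
Qed.

Lemma indep3_comp2 X Y Z (f : R * R -> R) :
  measurable_fun setT X -> measurable_fun setT Y -> measurable_fun setT Z ->
  measurable_fun setT f -> indep3 P X Y Z ->
  indep2 P Z (fun w => f (X w, Y w)).
Proof.
move=> mX mY mZ mf XYZ A B mA mB.
rewrite setIC mulrC; apply: (@indep3_pair X Y Z (f @^-1` B)) => //.
by rewrite -[X in measurable X]setTI; exact: mf.
Qed.

(** By Fubini the probability is the integral of [P(X = t - y)] over the law of [Y], and the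
    integrand vanishes. *)
Lemma indep2_add_atomless X Y (t : R) :
  measurable_fun setT X -> measurable_fun setT Y -> indep2 P X Y ->
  (forall c, pr P [set w | X w = c] = 0) -> pr P [set w | X w + Y w = t] = 0.
Proof.
move=> mX mY XY X0.
have fX : X \in mfun by rewrite inE.
have fY : Y \in mfun by rewrite inE.
(* The order is [(Y, X)]: the product measure integrates, over its first coordinate, the measure of
   sections in the second, and these sections must be single points for [X]. *)
pose m1 := distribution P (mfun_Sub fY); pose m2 := distribution P (mfun_Sub fX).
pose A : set (R * R) := [set z | z.2 + z.1 = t].
have mA : measurable A.
  have mf : measurable_fun setT (fun z : R * R => z.2 + z.1).
    by apply: measurable_funD; [exact: measurable_snd|exact: measurable_fst].
  by rewrite -[X in measurable X]setTI; exact: (mf measurableT [set t]).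
have mYX : measurable_fun setT (fun w => (Y w, X w)) by exact: measurable_fun_pair.
pose m' : {measure set (R * R) -> \bar R} :=
  measure_function_pushforward__canonical__measure_function_Measure P mYX.
have h : (m1 \x m2)%E A = m' A.
  apply: product_measure_unique => // C D mC mD.
  have mC' := preimage_measurable mY mC; have mD' := preimage_measurable mX mD.
  rewrite /m' /m1 /m2 /= /distribution /pushforward /=.
  rewrite -[X in P X = _]/(Y @^-1` C `&` X @^-1` D) setIC.
  rewrite -!prK // ?XY // -?EFinM 1?mulrC //.
  exact: measurableI.
have mE : measurable [set w | X w + Y w = t].
  exact: (preimage_measurable (measurable_funD mX mY) (measurable_set1 t)).
apply: EFin_inj; rewrite prK // -[LHS]/(m' A) -h /product_measure1.
apply: integral0_eq => y _ /=.
have -> : xsection A y = [set t - y].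
  apply/seteqP; split => x; rewrite /xsection /= inE /A /=.
    by move=> <-; rewrite addrK.
  by move=> ->; rewrite subrK.
rewrite /m2 /distribution /pushforward /= -prK; last exact: preimage_measurable.
by rewrite -[X in pr P X]/[set w | X w = t - y] X0.
Qed.

End joint_law.

Section independent.
Context d (T : measurableType d) (R : realType) (P : probability T R).

(** The law of the reciprocal of a uniform variable. At [x = 1] it says that [Z > 1] almost
    surely. *)
Definition pareto_tail (Z : T -> R) : Prop :=
  forall x, 1 <= x -> pr P [set w | x < Z w] = x^-1.

Lemma pareto_scale (Z : T -> R) (a x : R) : 0 < a -> a <= 1 -> 1 <= x ->
  pareto_tail Z -> pr P [set w | x < a * Z w] = a / x.
Proof. by move=> a0 a1 x1 hZ; rewrite gt_pscale // hZ ?ge1_divr // invf_div. Qed.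

Lemma pareto_le0 (Z : T -> R) : measurable_fun setT Z -> pareto_tail Z ->
  pr P [set w | Z w <= 0] = 0.
Proof.
move=> mZ hZ; apply/eqP; rewrite eq_le pr_ge0 andbT.
have := prC P (measurable_gt 1 mZ); rewrite setC_gt hZ // invr1 subrr => Y1.
rewrite -[leRHS]Y1; apply: le_pr; [exact: measurable_le|exact: measurable_le|].
by move=> w /= /le_trans; apply; exact: ler01.
Qed.

(* If [a Z + b Z'] exceeds [y] while neither term exceeds [y - sqrt y], then
   both exceed [sqrt y] and one exceeds [y / 2]. *)
Lemma pareto_sum_tail (Z Z' : T -> R) (a b y : R) :
  0 < a -> 0 < b -> a + b <= 1 ->
  measurable_fun setT Z -> measurable_fun setT Z' -> indep2 P Z Z' ->
  pareto_tail Z -> pareto_tail Z' -> 1 <= y ->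
  `|pr P [set w | y < a * Z w + b * Z' w] - (a + b) / y| <= 8 / pow32 y.
Proof.
move=> a0 b0 ab mZ mZ' ZZ' hZ hZ' y1.
have y0 : 0 < y by lra.
have maZ : measurable_fun setT (fun w => a * Z w) by exact: measurable_funM.
have mbZ : measurable_fun setT (fun w => b * Z' w) by exact: measurable_funM.
have mS : measurable_fun setT (fun w => a * Z w + b * Z' w).
  exact: measurable_funD.
pose s := Num.sqrt y.
have s1 : 1 <= s by rewrite -(@sqrtr1 R) ler_sqrt // ltW.
have yE : y = s ^+ 2 by rewrite sqr_sqrtr // ltW.
have p0 := pr_ge0 P [set w | y < a * Z w + b * Z' w].
have p1 := pr_le1 P (measurable_gt y mS).
have ab0 : 0 <= (a + b) / y by rewrite divr_ge0 //; lra.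
have ab1 : (a + b) / y <= 1 by rewrite ler_pdivrMr // mul1r; lra.
rewrite {3}yE pow32_sqr; last lra.
have s30 : 0 < s ^+ 3 by rewrite exprn_gt0; lra.
(* For [s <= 2] the bound [8 / s^3] is at least 1, while both compared quantities lie in [0, 1]. *)
have [s2|s2] := leP s 2.
  have : 1 <= 8 / s ^+ 3.
    rewrite ler_pdivlMr // mul1r.
    have -> : 8 = 2 ^+ 3 :> R by rewrite -natrX.
    by rewrite lerXn2r ?nnegrE; lra.
  by rewrite ler_norml; lra.
have maZy x := measurable_gt x maZ; have mbZy x := measurable_gt x mbZ.
have aZ x : 1 <= x -> pr P [set w | x < a * Z w] = a / x.
  by move=> x1; apply: pareto_scale => //; lra.
have bZ x : 1 <= x -> pr P [set w | x < b * Z' w] = b / x.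
  by move=> x1; apply: pareto_scale => //; lra.
have abZ x z : 1 <= x -> 1 <= z ->
    pr P ([set w | x < a * Z w] `&` [set w | z < b * Z' w]) = a / x * (b / z).
  move=> x1 z1; rewrite gt_pscale // (gt_pscale _ _ b0) indep2_gt //.
  by rewrite -(gt_pscale _ _ a0) -(gt_pscale _ _ b0) aZ // bZ.
rewrite ler_norml; apply/andP; split.
(* Off a null set both terms are positive, so a single term above [y] suffices. Inclusion-exclusion
   then loses only [a b / y^2]. *)
- have : pr P ([set w | y < a * Z w] `|` [set w | y < b * Z' w]) <=
     pr P [set w | y < a * Z w + b * Z' w].
    apply: (@le_pr_mod0 _ _ _ _ _ _ ([set w | Z w <= 0] `|` [set w | Z' w <= 0])).
    + exact: measurableU.
    + exact: measurable_gt.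
    + by apply: measurableU; exact: measurable_le.
    + by rewrite prU_eq0 ?pareto_le0 //; exact: measurable_le.
    move=> w /= h.
    have [z0|z0] := leP (Z w) 0; first by right; left.
    have [z0'|z0'] := leP (Z' w) 0; first by right; right.
    have := mulr_gt0 a0 z0; have := mulr_gt0 b0 z0'.
    by left; case: h; lra.
  rewrite prU // aZ // bZ // abZ //.
  have : a / y * (b / y) <= 8 / s ^+ 3.
    have -> : a / y * (b / y) = (a * b / s) / s ^+ 3.
      by rewrite yE; field; lra.
    rewrite ler_pM2r ?invr_gt0 // ler_pdivrMr; last lra.
    nra.
  rewrite mulrDl; lra.
- have ys : 1 <= y - s by rewrite yE; nra.
  have y2 : 1 <= y / 2 by rewrite yE; nra.
  pose A1 := [set w | y - s < a * Z w]; pose A2 := [set w | y - s < b * Z' w].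
  pose A3 := [set w | s < a * Z w] `&` [set w | y / 2 < b * Z' w].
  pose A4 := [set w | y / 2 < a * Z w] `&` [set w | s < b * Z' w].
  have m3 : measurable A3 by exact: measurableI.
  have m4 : measurable A4 by exact: measurableI.
  have m12 : measurable (A1 `|` A2) by apply: measurableU; [exact: maZy|exact: mbZy].
  have m123 : measurable (A1 `|` A2 `|` A3) := measurableU _ _ m12 m3.
  have : pr P [set w | y < a * Z w + b * Z' w] <= pr P (A1 `|` A2 `|` A3 `|` A4).
    apply: le_pr; [exact: measurable_gt|exact: measurableU m123 m4|].
    move=> w /= h; rewrite /A1 /A2 /A3 /A4 /=.
    have [?|h1] := ltP (y - s) (a * Z w); first by left; left; left.
    have [?|h2] := ltP (y - s) (b * Z' w); first by left; left; right.
    have [?|h3] := ltP (y / 2) (b * Z' w).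
      by left; right; split => //; lra.
    by right; split; lra.
  have := prU_le P m123 m4; have := prU_le P m12 m3.
  have := prU_le P (maZy (y - s)) (mbZy (y - s)).
  rewrite /A3 /A4 /A1 /A2 !abZ ?(ltW s1) // aZ // bZ //; try lra.
  have e1 : a / s * (b / (y / 2)) <= 2 / s ^+ 3.
    have -> : a / s * (b / (y / 2)) = (a * b * 2) / s ^+ 3.
      by rewrite yE; field; lra.
    by rewrite ler_pM2r ?invr_gt0 //; nra.
  have e2 : a / (y / 2) * (b / s) <= 2 / s ^+ 3.
    have -> : a / (y / 2) * (b / s) = (a * b * 2) / s ^+ 3.
      by rewrite yE; field; lra.
    by rewrite ler_pM2r ?invr_gt0 //; nra.
  (* As [y - s = s (s - 1)] and [s > 2], lowering the level from [y] to [y - s] costs at most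
     [2 / s^3]. *)
  have e3 : a / (y - s) + b / (y - s) <= (a + b) / y + 2 / s ^+ 3.
    have -> : a / (y - s) + b / (y - s) = (a + b) / y + (a + b) * (s / (s - 1)) / s ^+ 3.
      rewrite yE; field; nra.
    rewrite lerD2l ler_pM2r ?invr_gt0 //.
    have : s / (s - 1) <= 2 by rewrite ler_pdivrMr; lra.
    have : 0 <= s / (s - 1) by rewrite divr_ge0; lra.
    nra.
  have : 0 < (s ^+ 3)^-1 by rewrite invr_gt0.
  lra.
Qed.

(** The jumping term has an exact tail. The other term is itself a sum, with tail known up to
    [O(y^(-3/2))] from [pareto_sum_tail]; its independence from [Z] comes from [indep3_comp2]. *)
Lemma independent_jump_tail (Z Z' Z'' : T -> R) (a b c : R) :
  0 < a -> 0 < b -> 0 < c -> a + b + c = 1 ->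
  measurable_fun setT Z -> measurable_fun setT Z' -> measurable_fun setT Z'' ->
  indep3 P Z Z' Z'' -> pareto_tail Z -> pareto_tail Z' -> pareto_tail Z'' ->
  tail_expansion (fun t => pr P (big_jump (fun w => a * Z w)
    (fun w => b * Z' w + c * Z'' w) t)) a (a * (b + c)).
Proof.
move=> a0 b0 c0 abc mZ mZ' mZ'' ZZZ hZ hZ' hZ''.
have mX : measurable_fun setT (fun w => a * Z w) by exact: measurable_funM.
have mY : measurable_fun setT (fun w => b * Z' w + c * Z'' w).
  by apply: measurable_funD; exact: measurable_funM.
have i23 := indep3_indep2 (indep3_rot ZZZ).
have mf : measurable_fun setT (fun z : R * R => b * z.1 + c * z.2).
  by apply: measurable_funD; exact: measurable_funM.
have i123 := indep3_comp2 mZ' mZ'' mZ mf (indep3_rot ZZZ).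
have XY x y : pr P ([set w | x < a * Z w] `&`
      [set w | b * Z' w + c * Z'' w <= y]) =
    pr P [set w | x < a * Z w] * pr P [set w | b * Z' w + c * Z'' w <= y].
  by rewrite gt_pscale // (indep2_gt_le _ _ i123).
have Y0 : pr P [set w | b * Z' w + c * Z'' w <= 0] = 0.
  apply/eqP; rewrite eq_le pr_ge0 andbT.
  have N0 := prU_eq0 (measurable_le 0 mZ') (measurable_le 0 mZ'')
    (pareto_le0 mZ' hZ') (pareto_le0 mZ'' hZ'').
  rewrite -[leRHS]N0; apply: le_pr; first exact: measurable_le.
    by apply: measurableU; exact: measurable_le.
  move=> w /= h; have [z0|z0] := leP (Z' w) 0; first by left.
  have [z0'|z0'] := leP (Z'' w) 0; first by right.
  have := mulr_gt0 b0 z0; have := mulr_gt0 c0 z0'; lra.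
have [] := @big_jump_tail _ _ _ P _ _ mX mY XY Y0 a (b + c) 8.
- exact: ltW.
- by rewrite ltW // addr_gt0.
- by [].
- move=> x x1; rewrite pareto_scale //; last lra.
  by rewrite subrr normr0 divr_ge0 // exprn_ge0; lra.
- by move=> y y1; apply: pareto_sum_tail => //; lra.
by move=> C h; exists C, 8 => t /h.
Qed.

Lemma independent_tail (Z1 Z2 Z3 : T -> R) (w1 w2 w3 : R) :
  0 < w1 -> 0 < w2 -> 0 < w3 -> w1 + w2 + w3 = 1 ->
  measurable_fun setT Z1 -> measurable_fun setT Z2 -> measurable_fun setT Z3 ->
  indep3 P Z1 Z2 Z3 -> pareto_tail Z1 -> pareto_tail Z2 -> pareto_tail Z3 ->
  tail_expansion (fun t => pr P [set w | t < w1 * Z1 w + w2 * Z2 w + w3 * Z3 w])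
    1 (2 * (w1 * w2 + w1 * w3 + w2 * w3)).
Proof.
move=> w10 w20 w30 ws m1 m2 m3 Z123 h1 h2 h3.
pose E (t : R) := [set w | t < w1 * Z1 w + w2 * Z2 w + w3 * Z3 w].
pose A1 := big_jump (fun w => w1 * Z1 w) (fun w => w2 * Z2 w + w3 * Z3 w).
pose A2 := big_jump (fun w => w2 * Z2 w) (fun w => w1 * Z1 w + w3 * Z3 w).
pose A3 := big_jump (fun w => w3 * Z3 w) (fun w => w1 * Z1 w + w2 * Z2 w).
have mS (X : T -> R) a : measurable_fun setT X -> measurable_fun setT (fun w => a * X w).
  by move=> ?; exact: measurable_funM.
have mA (X Y : T -> R) a b : measurable_fun setT X -> measurable_fun setT Y ->
    measurable_fun setT (fun w => a * X w + b * Y w).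
  by move=> ? ?; apply: measurable_funD; exact: mS.
have t1 : tail_expansion (fun t => pr P (A1 t)) w1 (w1 * (w2 + w3)).
  by apply: independent_jump_tail => //; lra.
have t2 : tail_expansion (fun t => pr P (A2 t)) w2 (w2 * (w1 + w3)).
  by apply: independent_jump_tail => //; [lra|exact: indep3_swap].
have t3 : tail_expansion (fun t => pr P (A3 t)) w3 (w3 * (w1 + w2)).
  by apply: independent_jump_tail => //; [lra|exact: indep3_rot (indep3_rot _)].
have -> : 2 * (w1 * w2 + w1 * w3 + w2 * w3) =
  w1 * (w2 + w3) + w2 * (w1 + w3) + w3 * (w1 + w2) by ring.
rewrite -[X in tail_expansion _ X]ws.
have h (Z : T -> R) : pareto_tail Z ->
    forall z, 1 <= z -> pr P [set w | z < Z w] <= z^-1.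
  by move=> hZ z z1; rewrite hZ.
apply: (@tail_expansion_of_three _ _ _ P _ _ _ m1 m2 m3 Z123 (h _ h1) (h _ h2)
  (h _ h3) E A1 A2 A3 _ _ _ _ _ _ _ _ _ _ _ _ _ _ _ t1 t2 t3).
- move=> t; apply: measurable_gt; apply: measurable_funD; last exact: mS.
  exact: mA.
- by move=> t; apply: measurable_big_jump; [exact: mS|exact: mA].
- by move=> t; apply: measurable_big_jump; [exact: mS|exact: mA].
- by move=> t; apply: measurable_big_jump; [exact: mS|exact: mA].
- move=> t t0 w; rewrite /E /A1 /A2 /A3 /big_jump /two_large /= => tE.
  have small a x : 0 < a -> x <= t / 8 -> a * x <= a * (t / 8).
    by move=> ? ?; rewrite ler_pM2l.
  have wt (a : R) : a < 1 -> a * (t / 8) <= t / 8.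
    by move=> a1; rewrite ger_pMl ?divr_gt0 // ltW.
  have := wt _ (_ : w1 < 1); have := wt _ (_ : w2 < 1); have := wt _ (_ : w3 < 1).
  move=> /(_ ltac:(lra)) q3 /(_ ltac:(lra)) q2 /(_ ltac:(lra)) q1.
  (* If at most one variable exceeds [t / 8], the other two terms add up to at most [t / 2], so that
     variable makes the jump. The case in which none does is absorbed in [A3]. *)
  have [l1|l1] := ltP (t / 8) (Z1 w).
    have [l2|l2] := ltP (t / 8) (Z2 w); first by right; left; left.
    have [l3|l3] := ltP (t / 8) (Z3 w); first by right; left; right.
    have := small _ _ w20 l2; have := small _ _ w30 l3.
    by left; left; left; split; lra.
  have [l2|l2] := ltP (t / 8) (Z2 w).
    have [l3|l3] := ltP (t / 8) (Z3 w); first by right; right.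
    have := small _ _ w10 l1; have := small _ _ w30 l3.
    by left; left; right; split; lra.
  have := small _ _ w10 l1; have := small _ _ w20 l2.
  by left; right; split; lra.
- move=> t t0 w; rewrite /E /A1 /A2 /A3 /big_jump /=.
  by move=> [[]|] [? _]; lra.
- move=> t t0 w [[/= h1' h2'] [/= h3' h4']]; left; left; split.
    by apply: (@large_factor _ w1); lra.
  by apply: (@large_factor _ w2); lra.
- move=> t t0 w [[/= h1' h2'] [/= h3' h4']]; left; right; split.
    by apply: (@large_factor _ w1); lra.
  by apply: (@large_factor _ w3); lra.
- move=> t t0 w [[/= h1' h2'] [/= h3' h4']]; right; split.
    by apply: (@large_factor _ w2); lra.
  by apply: (@large_factor _ w3); lra.
Qed.

End independent.

(** * From [1/u] to general scores *)

Section scores.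
Context (R : realType).
Implicit Types u v x : R.

(** By the mean value theorem [k] is the cosine of an intermediate point, and cosine decreases
    there. *)
Lemma sin_chord x : 0 < x -> x < pi / 2 ->
  exists2 k : R, cos x <= k <= 1 & sin x = k * x.
Proof.
move=> x0 xpi.
have [] := @MVT R (@sin R) (@cos R) 0 x x0 (fun y _ => is_derive_sin y).
  by apply: continuous_subspaceT => y; exact: continuous_sin.
move=> c; rewrite in_itv /= => /andP[c0 cx]; rewrite sin0 !subr0 => e.
have pi0 := @pi_gt0 R.
exists (cos c) => //; rewrite cos_le1 andbT ltW // ltr_cos // in_itv /=.
  by apply/andP; split; lra.
by apply/andP; split; lra.
Qed.

(** The upper bound is [x cos x <= sin x]. The lower one is [sin x <= x <= x (cos x + sin x)], where
    [cos x + sin x >= 1] because both lie in [0, 1] and their squares add up to 1. *)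
Lemma cot_bounds x : 0 < x -> x < pi / 2 -> x^-1 - 1 <= cot x <= x^-1.
Proof.
move=> x0 xpi; have [k /andP[ck k1] sk] := sin_chord x0 xpi.
have s0 : 0 < sin x by apply: sin_gt0_pihalf; rewrite x0.
have c0 : 0 < cos x by apply: cos_gt0_pihalf; rewrite xpi andbT; have := @pi_gt0 R; lra.
have sc := cos2Dsin2 x.
have s1 := sin_le1 x; have c1 := cos_le1 x.
rewrite /cot; apply/andP; split; last first.
  by rewrite ler_pdivrMr // mulrC ler_pdivlMr // sk; nra.
rewrite ler_pdivlMr // -(ler_pM2r x0).
have -> : (x^-1 - 1) * sin x * x = sin x - x * sin x by field; lra.
have sx : sin x <= x by rewrite sk; nra.
have : 1 <= cos x + sin x by nra.
nra.
Qed.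

Lemma score_arg_itv u : 0 < u < 1 -> 0 < pi * u / 2 < pi / 2.
Proof.
move=> /andP[u0 u1]; have pi0 := @pi_gt0 R; apply/andP; split.
  by rewrite !mulr_gt0.
by rewrite ltr_pM2r // gtr_pMr.
Qed.

Lemma tail_const_gt0 (S : statistic) : 0 < tail_const R S.
Proof. by case: S => //=; rewrite divr_gt0 // pi_gt0. Qed.

Lemma score_bounds (S : statistic) u : 0 < u < 1 ->
  tail_const R S / u - 1 <= score S u <= tail_const R S / u.
Proof.
case: S => /= u01; first by rewrite div1r lexx andbT gerBl.
have /andP[x0 xpi] := score_arg_itv u01.
have := cot_bounds x0 xpi.
by have -> // : (pi * u / 2)^-1 = 2 / pi / u; rewrite !invfM invrK mulrC mulrA.
Qed.

(** Equal cotangents give [sin (y - x) = 0] with [y - x] strictly between [-pi] and [pi].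
    Injectivity reduces atoms of a score to atoms of the uniform law. *)
Lemma score_inj (S : statistic) u v : 0 < u < 1 -> 0 < v < 1 ->
  score S u = score S v -> u = v.
Proof.
case: S => /= u01 v01; first exact: invr_inj.
have /andP[x0 xpi] := score_arg_itv u01.
have /andP[y0 ypi] := score_arg_itv v01.
set x := pi * u / 2 in x0 xpi *; set y := pi * v / 2 in y0 ypi *.
have pi0 := @pi_gt0 R.
have sx : 0 < sin x by apply: sin_gt0_pihalf; rewrite x0.
have sy : 0 < sin y by apply: sin_gt0_pihalf; rewrite y0.
rewrite /cot => /eqP; rewrite eqr_div ?lt0r_neq0 // => /eqP e.
have d0 : sin (y - x) = 0 by rewrite sinB (mulrC (sin y)) e subrr.
have xy : x = y.
  have [xy|yx|//] := ltgtP x y.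
    have : 0 < sin (y - x) by apply: sin_gt0_pi; apply/andP; split; lra.
    by rewrite d0 ltxx.
  have : 0 < sin (x - y) by apply: sin_gt0_pi; apply/andP; split; lra.
  by rewrite -opprB sinN d0 oppr0 ltxx.
move: xy; rewrite /x /y => /divIf; rewrite pnatr_eq0 => /(_ isT).
by move/mulfI; apply; rewrite gt_eqF.
Qed.

End scores.

(** Passing from [t] to [t + 1] changes [c / t] by [O(t^-2)] and [ln t / t^2] by even less, and the
    factor [1 / c] inside the logarithm adds a constant multiple of [t^-2]. *)
Lemma tail_expansion_rescale (R : realType) (G H : R -> R) (c s : R) :
  0 < c -> 0 <= s -> tail_expansion G 1 s ->
  (forall t, G ((t + 1) / c) <= H t <= G (t / c)) ->
  tail_expansion H c (c ^+ 2 * s).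
Proof.
move=> c0 s0 [C [T hG]] HG.
(* In order: the error of [G], the constant [ln c] split off the logarithm, and the cost of
   replacing [t + 1] by [t] in [c / (t + 1)] and in [ln (t + 1) / (t + 1)^2]. *)
exists (c ^+ 2 * `|C| + s * c ^+ 2 * `|ln c| + c + 2 * (s * c ^+ 2)), (Num.max 1 (c * T)).
move=> t; rewrite ge_max => /andP[t1 cT].
have t0 : 0 < t by lra.
have /andP[Hl Hu] := HG t.
have h1 : T <= t / c by rewrite ler_pdivlMr // mulrC.
have h2 : T <= (t + 1) / c by apply: (le_trans h1); rewrite ler_pM2r ?invr_gt0 //; lra.
have c2 : 0 <= s * c ^+ 2 by rewrite mulr_ge0 // sqr_ge0.
have i2 : 0 < (t ^+ 2)^-1 by rewrite invr_gt0 exprn_gt0.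
have j2 : 0 < ((t + 1) ^+ 2)^-1 by rewrite invr_gt0 exprn_gt0 //; lra.
have ij : ((t + 1) ^+ 2)^-1 <= (t ^+ 2)^-1.
  by rewrite lef_pV2 ?posrE ?exprn_gt0 //; nra.
have lt0 : 0 <= ln t by exact: ln_ge0.
have lt1 := ln_le_subr1 t0.
have nC := ler_norm C; have nC0 := normr_ge0 C.
have := ler_norm (ln c); have := ler_norm (- ln c); rewrite normrN => l1 l2.
have l0 := normr_ge0 (ln c).
have D0 : 0 <= c ^+ 2 * `|C| by rewrite mulr_ge0 // sqr_ge0.
have D1 : 0 <= s * c ^+ 2 * `|ln c| by rewrite mulr_ge0.
rewrite ler_norml; apply/andP; split.
- have := hG _ h2; rewrite ler_norml => /andP[+ _].
  have e1 : 1 / ((t + 1) / c) = c / (t + 1) by field; lra.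
  have e2 : C / ((t + 1) / c) ^+ 2 = c ^+ 2 * C / (t + 1) ^+ 2 by field; lra.
  have e3 : s * (ln ((t + 1) / c) / ((t + 1) / c) ^+ 2) =
     s * c ^+ 2 * (ln (t + 1) / (t + 1) ^+ 2) - s * c ^+ 2 * ln c / (t + 1) ^+ 2.
    by rewrite ln_div ?posrE //; [field; lra|lra].
  rewrite e1 e2 e3 => hl.
  have f1 : c / t - c / t ^+ 2 <= c / (t + 1).
    rewrite ler_pdivlMr; last lra.
    have -> : (c / t - c / t ^+ 2) * (t + 1) = c - c / t ^+ 2 by field; lra.
    by rewrite gerBl mulr_ge0 // ltW.
  have f2 : c ^+ 2 * C / (t + 1) ^+ 2 <= c ^+ 2 * `|C| / t ^+ 2.
    apply: (@le_trans _ _ (c ^+ 2 * `|C| / (t + 1) ^+ 2)).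
      by rewrite ler_pM2r // ler_wpM2l // sqr_ge0.
    by rewrite ler_wpM2l.
  have f3 : s * c ^+ 2 * ln c / (t + 1) ^+ 2 <= s * c ^+ 2 * `|ln c| / t ^+ 2.
    apply: (@le_trans _ _ (s * c ^+ 2 * `|ln c| / (t + 1) ^+ 2)).
      by rewrite ler_pM2r // ler_wpM2l.
    by rewrite ler_wpM2l.
  have f4 : s * c ^+ 2 * (ln t / t ^+ 2 - 2 / t ^+ 2) <=
      s * c ^+ 2 * (ln (t + 1) / (t + 1) ^+ 2).
    apply: ler_wpM2l => //.
    apply: (@le_trans _ _ (ln t / (t + 1) ^+ 2)); last first.
      by rewrite ler_pM2r // ler_ln ?posrE //; lra.
    rewrite ler_pdivlMr ?exprn_gt0 //; last lra.
    have -> : (ln t / t ^+ 2 - 2 / t ^+ 2) * (t + 1) ^+ 2 =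
      ln t - (2 * (t + 1) ^+ 2 - ln t * (2 * t + 1)) / t ^+ 2 by field; lra.
    rewrite gerBl divr_ge0 ?sqr_ge0 //; nra.
  lra.
- have := hG _ h1; rewrite ler_norml => /andP[_].
  have e1 : 1 / (t / c) = c / t by field; lra.
  have e2 : C / (t / c) ^+ 2 = c ^+ 2 * C / t ^+ 2 by field; lra.
  have e3 : s * (ln (t / c) / (t / c) ^+ 2) =
     s * c ^+ 2 * (ln t / t ^+ 2) - s * c ^+ 2 * ln c / t ^+ 2.
    by rewrite ln_div ?posrE //; field; lra.
  rewrite e1 e2 e3 => hu.
  have f2 : c ^+ 2 * C / t ^+ 2 <= c ^+ 2 * `|C| / t ^+ 2.
    by rewrite ler_pM2r // ler_wpM2l // sqr_ge0.
  have f3 : - (s * c ^+ 2 * ln c / t ^+ 2) <= s * c ^+ 2 * `|ln c| / t ^+ 2.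
    rewrite -mulNr ler_pM2r // -mulrN ler_wpM2l //; lra.
  have f4 : 0 <= c / t ^+ 2 by rewrite mulr_ge0 // ltW.
  have f5 : 0 <= s * c ^+ 2 / t ^+ 2 by rewrite mulr_ge0 // ltW.
  lra.
Qed.

(** * Expansions at the first-order threshold and at the quantile *)

Section asymptotics.
Context (R : realType).
Implicit Types (f p : R -> R) (a c s t : R).

Lemma tail_expansion_diff f p c s s' : tail_expansion f c s -> tail_expansion p c s' ->
  exists C T : R, forall t, T <= t ->
    `|f t - p t - (s - s') * (ln t / t ^+ 2)| <= C / t ^+ 2.
Proof.
move=> [C [T hf]] [C' [T' hp]]; exists (C + C'), (Num.max T T') => t.
rewrite ge_max => /andP[/hf{}hf /hp{}hp].
have -> : f t - p t - (s - s') * (ln t / t ^+ 2) =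
  (f t - c / t - s * (ln t / t ^+ 2)) - (p t - c / t - s' * (ln t / t ^+ 2)) by ring.
by rewrite mulrDl; apply: (le_trans (ler_normB _ _)); exact: lerD.
Qed.

(** Substitute [t = c / a]: the logarithm splits as [ln c + ln (1/a)], and the part with [ln c] is
    absorbed in [O(a^2)]. *)
Lemma tail_expansion_first_order_threshold f c s : 0 < c -> tail_expansion f c s ->
  exists C d : R, 0 < d /\ forall a, 0 < a -> a < d ->
    `|f (c / a) - (a + s / c ^+ 2 * a ^+ 2 * ln a^-1)| <= C * a ^+ 2.
Proof.
move=> c0 [C [T hf]].
exists (C / c ^+ 2 + `|s / c ^+ 2 * ln c|), (c / (`|T| + 1)).
have T0 : 0 < `|T| + 1 by rewrite ltr_wpDl.
split=> [|a a0 ad]; first exact: divr_gt0.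
have Tt : T <= c / a.
  rewrite ler_pdivlMr //; move: ad; rewrite ltr_pdivlMr // => ad.
  have := ler_norm T; nra.
have := hf _ Tt.
have -> : c / (c / a) = a by field; lra.
have -> : s * (ln (c / a) / (c / a) ^+ 2) =
    s / c ^+ 2 * a ^+ 2 * ln a^-1 + s / c ^+ 2 * ln c * a ^+ 2.
  by rewrite lnM ?posrE ?invr_gt0 //; field; lra.
have -> : C / (c / a) ^+ 2 = C / c ^+ 2 * a ^+ 2 by field; lra.
move=> h; rewrite mulrDl.
have -> : f (c / a) - (a + s / c ^+ 2 * a ^+ 2 * ln a^-1) =
  (f (c / a) - a - (s / c ^+ 2 * a ^+ 2 * ln a^-1 + s / c ^+ 2 * ln c * a ^+ 2))
  + s / c ^+ 2 * ln c * a ^+ 2 by ring.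
apply: (le_trans (ler_normD _ _)); apply: lerD => //.
by rewrite normrM (ger0_norm (sqr_ge0 a)).
Qed.

Lemma ln_le_sqrt t : 0 < t -> ln t + 1 <= 2 * Num.sqrt t.
Proof.
move=> t0; set r := Num.sqrt t.
have r0 : 0 < r by rewrite sqrtr_gt0.
have -> : t = r ^+ 2 by rewrite sqr_sqrtr // ltW.
rewrite lnXn // -mulr_natl; have := ln_le_subr1 r0; lra.
Qed.

(* With [q] the quantile at level [a], [r := q a / c] tends to 1 fast enough
   for [c^2 ln q / q^2] and [a^2 ln (1/a)] to differ by [O(a^2)]. *)
Lemma quantile_log_term (c K q a : R) :
  0 < c -> 0 <= K -> 0 < a -> 1 <= q -> 16 * K ^+ 2 <= q ->
  `|q * a / c - 1| <= K * (ln q + 1) / q ->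
  (q ^+ 2)^-1 <= 4 / c ^+ 2 * a ^+ 2 /\
  `|ln q / q ^+ 2 - a ^+ 2 * ln a^-1 / c ^+ 2| <=
    (12 * K + 3 * (`|ln c| + 1)) / q ^+ 2.
Proof.
move=> c0 K0 a0 q1 Kq; set r := q * a / c => hr.
have q0 : 0 < q by lra.
have i2 : 0 < (q ^+ 2)^-1 by rewrite invr_gt0 exprn_gt0.
have lq0 : 0 <= ln q by exact: ln_ge0.
have lq := ln_le_sqrt q0.
have z0 : 0 < Num.sqrt q by rewrite sqrtr_gt0.
have z2 : Num.sqrt q ^+ 2 = q by rewrite sqr_sqrtr // ltW.
have Kz : 4 * K <= Num.sqrt q.
  by rewrite -(ler_pXn2r (ltn0Sn 1)) ?nnegrE; nra.
(* By [ln_le_sqrt] the bound on [r - 1] is at most [2 K / sqrt q], hence at most [1 / 2]. *)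
have r12 : `|r - 1| <= 1 / 2.
  apply: (le_trans hr); rewrite ler_pdivrMr //; nra.
move: (r12); rewrite ler_norml => /andP[r1 r2].
have r0 : 0 < r by lra.
have aE : a = c * r / q by rewrite /r; field; lra.
have lr1 := ln_le_subr1 r0.
have lr2 : -1 <= ln r.
  have := @ln_le_subr1 R r^-1; rewrite invr_gt0 lnV ?posrE // => /(_ r0).
  have : r^-1 <= 2 by rewrite -[leRHS]invrK lef_pV2 ?posrE //; lra.
  lra.
split.
  rewrite aE; have -> : 4 / c ^+ 2 * (c * r / q) ^+ 2 = (4 * r ^+ 2) / q ^+ 2.
    by field; lra.
  by rewrite -[leLHS]mul1r ler_pM2r //; nra.
have -> : ln q / q ^+ 2 - a ^+ 2 * ln a^-1 / c ^+ 2 =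
    ((1 - r ^+ 2) * ln q + r ^+ 2 * (ln c + ln r)) / q ^+ 2.
  have -> : ln a^-1 = ln q - (ln c + ln r).
    have cr0 : 0 < c * r by exact: mulr_gt0.
    by rewrite lnV ?posrE // {1}aE ln_div ?posrE // lnM ?posrE // opprB.
  by rewrite aE; field; lra.
rewrite normrM (gtr0_norm i2) ler_pM2r //.
apply: (le_trans (ler_normD _ _)); apply: lerD.
  (* As [1 + r <= 3], this term is at most [3 K (ln q + 1)^2 / q], and [(ln q + 1)^2 <= 4 q] gives
     [12 K]. *)
  have -> : 1 - r ^+ 2 = - ((r - 1) * (1 + r)) by ring.
  rewrite mulNr normrN !normrM (ger0_norm lq0) (gtr0_norm (_ : 0 < 1 + r)); last lra.
  have h : `|r - 1| * q <= K * (ln q + 1) by rewrite -ler_pdivlMr.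
  have h3 : `|r - 1| * (1 + r) * ln q <= 3 * (`|r - 1| * (ln q + 1)).
    have := mulr_ge0 (normr_ge0 (r - 1)) lq0.
    have := normr_ge0 (r - 1); nra.
  apply: (le_trans h3).
  suff : `|r - 1| * (ln q + 1) <= 4 * K by lra.
  rewrite -(ler_pM2r q0).
  have : `|r - 1| * q * (ln q + 1) <= K * (ln q + 1) * (ln q + 1).
    by rewrite ler_wpM2r //; lra.
  have : K * ((ln q + 1) * (ln q + 1)) <= K * (4 * q).
    apply: ler_wpM2l => //; nra.
  lra.
rewrite normrM (ger0_norm (sqr_ge0 r)).
have : `|ln c + ln r| <= `|ln c| + 1.
  by apply: (le_trans (ler_normD _ _)); rewrite lerD2l ler_norml; lra.
have r3 : r ^+ 2 <= 3 by nra.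
have := ler_wpM2r (normr_ge0 (ln c + ln r)) r3; lra.
Qed.

(** Since [p (Q a) = a], the value [f (Q a)] is [a] plus the difference of the two tails at [Q a],
    whose leading terms cancel; [quantile_log_term] rewrites the logarithmic term in [a]. *)
Lemma tail_expansion_quantile f p (Q : R -> R) c s s' : 0 < c -> 0 <= s ->
  tail_expansion f c s' -> tail_expansion p c s ->
  (forall t t', t <= t' -> p t' <= p t) ->
  (forall a, 0 < a < 1 -> p (Q a) = a) ->
  exists C d : R, 0 < d /\ forall a, 0 < a -> a < d ->
    `|f (Q a) - (a + (s' - s) / c ^+ 2 * a ^+ 2 * ln a^-1)| <= C * a ^+ 2.
Proof.
move=> c0 s0 hf hp p_dec pQ.
have [C [T hD]] := tail_expansion_diff hf hp; have {hf hp}[C' [T' hp]] := hp.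
pose K := (s + `|C'|) / c.
have K0 : 0 <= K by rewrite divr_ge0 ?addr_ge0 // ltW.
(* Beyond [T1] the expansions of [p] and of [f - p] hold and [quantile_log_term] applies. The last
   entry makes [c / t] dominate [C' / t^2] at [T1], whence [p T1 > 0]. *)
pose T1 := Num.max 1 (Num.max T (Num.max T' (Num.max (16 * K ^+ 2) (2 * `|C'| / c + 1)))).
have nC := ler_norm C'; have nC0 := normr_ge0 C'.
have : T1 <= T1 by [].
rewrite {1}/T1 !ge_max => /and5P[T11 _ TT' _ TC].
have pT1 : 0 < p T1.
  have T10 : 0 < T1 by lra.
  have := hp _ TT'; rewrite ler_norml => /andP[+ _].
  have : 0 <= s * (ln T1 / T1 ^+ 2).
    by rewrite mulr_ge0 // divr_ge0 ?sqr_ge0 // ln_ge0.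
  have : C' / T1 ^+ 2 < c / T1.
    have -> : C' / T1 ^+ 2 = (C' / T1) / T1 by field; lra.
    rewrite ltr_pM2r ?invr_gt0 // ltr_pdivrMr //.
    have := TC; rewrite -lerBrDr ler_pdivrMr //; nra.
  lra.
pose M := 12 * K + 3 * (`|ln c| + 1).
exists ((`|C| + `|s' - s| * M) * (4 / c ^+ 2)), (Num.min 1 (p T1)).
split=> [|a a0]; first by rewrite lt_min ltr01.
rewrite lt_min => /andP[a1 aT].
have pq : p (Q a) = a by apply: pQ; rewrite a0.
(* A quantile below [T1] would give [a = p (Q a) >= p T1]; so small levels force large quantiles. *)
have : T1 <= Q a.
  by rewrite leNgt; apply/negP => /ltW /p_dec; rewrite pq leNgt aT.
move: pq; move: (Q a) => q pq.
rewrite {1}/T1 !ge_max => /and5P[q1 qT qT' qK _].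
have q0 : 0 < q by lra.
have i2 : 0 < (q ^+ 2)^-1 by rewrite invr_gt0 exprn_gt0.
have lq0 : 0 <= ln q by exact: ln_ge0.
(* Multiply the expansion of [a = p q] by [q / c]; the constant [K] bounds both the logarithmic term
   and the error. *)
have hr : `|q * a / c - 1| <= K * (ln q + 1) / q.
  have := hp _ qT'; rewrite pq => h.
  have -> : q * a / c - 1 = (a - c / q) * (q / c) by field; lra.
  rewrite normrM (gtr0_norm (divr_gt0 q0 c0)).
  have : `|a - c / q| <= (s * ln q + `|C'|) / q ^+ 2.
    have -> : a - c / q = (a - c / q - s * (ln q / q ^+ 2)) + s * (ln q / q ^+ 2).
      by ring.
    apply: (le_trans (ler_normD _ _)); rewrite mulrDl addrC; apply: lerD.
      by rewrite mulrA ger0_norm // divr_ge0 ?sqr_ge0 // mulr_ge0.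
    by apply: (le_trans h); rewrite ler_pM2r.
  move=> /(ler_wpM2r (ltW (divr_gt0 q0 c0))) /le_trans; apply.
  have -> : (s * ln q + `|C'|) / q ^+ 2 * (q / c) = ((s * ln q + `|C'|) / c) / q.
    by field; lra.
  rewrite ler_pM2r ?invr_gt0 // /K mulrAC ler_pM2r ?invr_gt0 //.
  have := mulr_ge0 nC0 lq0; lra.
have [hi hl] := quantile_log_term c0 K0 a0 q1 qK hr.
have M0 : 0 <= `|C| + `|s' - s| * M.
  rewrite addr_ge0 // mulr_ge0 // /M; have := normr_ge0 (ln c); lra.
apply: (@le_trans _ _ ((`|C| + `|s' - s| * M) / q ^+ 2)); last first.
  by rewrite -mulrA ler_wpM2l.
have -> : f q - (a + (s' - s) / c ^+ 2 * a ^+ 2 * ln a^-1) =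
  (f q - p q - (s' - s) * (ln q / q ^+ 2)) +
  (s' - s) * (ln q / q ^+ 2 - a ^+ 2 * ln a^-1 / c ^+ 2) by rewrite pq; ring.
apply: (le_trans (ler_normD _ _)); rewrite [leRHS]mulrDl; apply: lerD.
  by apply: (le_trans (hD _ qT)); rewrite ler_pM2r // ler_norm.
by rewrite normrM -[leRHS]mulrA ler_wpM2l.
Qed.

End asymptotics.

(** * Existence of the upper quantile *)

Section quantile.
Context d (T : measurableType d) (R : realType) (P : probability T R).

Lemma pr_bigcup_le (F : (set T)^nat) (a : R) :
  (forall n, measurable (F n)) -> nondecreasing_seq F ->
  (forall n, pr P (F n) <= a) -> pr P (\bigcup_n F n) <= a.
Proof.
move=> mF ndF Fa.
have mU : measurable (\bigcup_n F n) by exact: bigcup_measurable.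
have cF := nondecreasing_cvg_mu mF mU ndF : P \o F @ \oo --> P (\bigcup_n F n).
rewrite -lee_fin prK // -(cvg_lim _ cF) //; apply: lime_le.
  by apply/cvg_ex; exists (P (\bigcup_n F n)).
by apply: nearW => n /=; rewrite -prK // lee_fin.
Qed.

(** Take [q = inf {t : P(X > t) <= a}]. Continuity from below gives [P(X > q) <= a] and
    [P(X < q) <= 1 - a]; as [q] is no atom, the latter yields the reverse inequality. *)
Lemma upper_quantile_exists (X : T -> R) (a : R) : measurable_fun setT X ->
  (forall t, pr P [set w | X w = t] = 0) -> 0 < a < 1 ->
  exists q, pr P [set w | q < X w] = a.
Proof.
move=> mX X0 /andP[a0 a1].
pose G t := pr P [set w | t < X w].
have mG t : measurable [set w | t < X w] by exact: measurable_gt.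
have mL t : measurable [set w | X w <= t] by exact: measurable_le.
have Gle t t' : t <= t' -> G t' <= G t.
  by move=> tt'; apply: le_pr => // w /=; exact: le_lt_trans.
have LE t : pr P [set w | X w <= t] = 1 - G t by rewrite -setC_gt prC.
have natle (m n : nat) : (m <= n)%N -> (m%:R : R) <= n%:R by rewrite ler_nat.
pose S := [set t | G t <= a].
have S0 : S !=set0.
  apply/not_existsP => nS.
  have : pr P (\bigcup_n [set w | X w <= n%:R]) <= 1 - a.
    apply: pr_bigcup_le => //.
      move=> m n mn; apply/subsetPset => w /= /le_trans; apply; exact: natle.
    by move=> n; rewrite LE lerD2l lerN2 ltW // ltNge; apply/negP; exact: nS.
  rewrite (_ : \bigcup_n _ = setT) ?pr_setT; first lra.
  apply/seteqP; split => // w _.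
  exists (Num.truncn `|X w|).+1 => //=.
  exact/ltW/(le_lt_trans (ler_norm _))/truncnS_gt.
have [lb hlb] : has_lbound S.
  apply: contrapT => nlb.
  have : pr P (\bigcup_n [set w | - n%:R < X w]) <= a.
    apply: pr_bigcup_le => //.
      move=> m n mn; apply/subsetPset => w /=; apply: le_lt_trans.
      by rewrite lerN2 natle.
    move=> n; rewrite leNgt; apply/negP => h; apply: nlb; exists (- n%:R).
    move=> t /= Gt; rewrite leNgt; apply/negP => /ltW /Gle; rewrite leNgt.
    by rewrite (le_lt_trans Gt).
  rewrite (_ : \bigcup_n _ = setT) ?pr_setT; first lra.
  apply/seteqP; split => // w _.
  exists (Num.truncn `|X w|).+1 => //=; rewrite ltrNl.
  by apply: (le_lt_trans _ (truncnS_gt _)); rewrite -normrN ler_norm.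
have hS : has_inf S by split => //; exists lb.
pose q := inf S; exists q; apply/eqP; rewrite eq_le; apply/andP; split.
  rewrite (_ : [set w | q < X w] = \bigcup_n [set w | q + n.+1%:R^-1 < X w]).
    apply: pr_bigcup_le => //.
      move=> m n mn; apply/subsetPset => w /=; apply: le_lt_trans.
      by rewrite lerD2l lef_pV2 ?posrE // ler_nat.
    move=> n; have n0 : 0 < (n.+1%:R : R)^-1 by rewrite invr_gt0.
    have [t St tq] := inf_adherent n0 hS.
    by apply: le_trans St; apply/Gle/ltW.
  apply/seteqP; split => w /=; last first.
    by move=> [n _] /=; apply: lt_trans; rewrite ltrDl invr_gt0.
  by move=> /ltr_add_invr[n h]; exists n.
have : pr P (\bigcup_n [set w | X w <= q - n.+1%:R^-1]) <= 1 - a.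
  apply: pr_bigcup_le => //.
    move=> m n mn; apply/subsetPset => w /= /le_trans; apply.
    by rewrite lerD2l lerN2 lef_pV2 ?posrE // ler_nat.
  move=> n; rewrite LE lerD2l lerN2 leNgt; apply/negP => /ltW h.
  have : q <= q - n.+1%:R^-1 by apply: ge_inf => //; exists lb.
  by rewrite lerBrDr gerDl invr_le0 leNgt ltr0n.
have mE : measurable [set w | X w = q].
  exact: (preimage_measurable mX (measurable_set1 q)).
have mU : measurable (\bigcup_n [set w | X w <= q - n.+1%:R^-1]).
  by exact: bigcup_measurable.
have := prU_le P mU mE; rewrite X0 addr0 => h1 h2.
suff : pr P [set w | X w <= q] <= 1 - a by rewrite LE /G; lra.
apply: (le_trans _ (le_trans h1 h2)); apply: le_pr => //; first exact: measurableU.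
move=> w /=; rewrite le_eqVlt => /predU1P[->|]; first by right.
move=> /ltr_add_invr[n h]; left; exists n => //=.
by rewrite lerBrDr ltW.
Qed.

End quantile.

(** * Laws of the variables *)

Section laws.
Context d (T : measurableType d) (R : realType) (P : probability T R).

Lemma mutually_independent_indep3 (X : 'I_3 -> {RV P >-> R}) :
  mutually_independent P X ->
  indep3 P (X ord0) (X (lift ord0 ord0)) (X (lift ord0 (lift ord0 ord0))).
Proof.
move=> XI A B C mA mB mC.
pose F : 'I_3 -> set R := triple A B C.
have mF i : measurable (F i).
  by rewrite /F /triple; case: i => -[|[|[|//]]] i3; rewrite (tnth_nth A).
have := XI F mF.
rewrite !big_ord_recl big_ord0 mule1.
have -> : \bigcap_(i in [set: 'I_3]) (X i @^-1` F i) =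
    X ord0 @^-1` A `&` X (lift ord0 ord0) @^-1` B
      `&` X (lift ord0 (lift ord0 ord0)) @^-1` C.
  apply/seteqP; split => w /=.
    move=> h; split; first split.
    - exact: (h ord0).
    - exact: (h (lift ord0 ord0)).
    - exact: (h (lift ord0 (lift ord0 ord0))).
  move=> [[hA hB] hC] i _ /=.
  by case: (unliftP ord0 i) => [j ->|-> //]; case: (unliftP ord0 j) => [k ->|-> //];
    rewrite (ord1 k).
have -> : F ord0 = A by [].
have -> : F (lift ord0 ord0) = B by [].
have -> : F (lift ord0 (lift ord0 ord0)) = C by [].
rewrite -!prK -?EFinM //; [|exact: measurable_funPTI..|].
  by move=> h; rewrite -mulrA; exact: EFin_inj h.
by apply: measurableI; [apply: measurableI|]; exact: measurable_funPTI.
Qed.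

Lemma uniform_itvoo (y : R) : 0 < y <= 1 ->
  uniform_prob (@ltr01 R) `]0, y[ = y%:E.
Proof.
move=> /andP[y0 y1]; rewrite /uniform_prob integral_uniform_pdf.
rewrite (_ : _ `&` _ = `]0, y[%classic); last first.
  apply/seteqP; split => x /=; first by case.
  move=> h; split => //; move: h; rewrite !in_itv /= => /andP[x0 xy].
  by rewrite ltW // ltW // (lt_le_trans xy).
rewrite (eq_integral (fun=> 1%E)); last first.
  move=> x; rewrite inE /= in_itv /= => /andP[x0 xy].
  by rewrite /uniform_pdf ltW //= (ltW (lt_le_trans xy y1)) subr0 invr1.
by rewrite integral_cst //= mul1e lebesgue_measure_itv /= lte_fin y0 oppr0 adde0.
Qed.

Lemma uniform_set1 (c : R) : uniform_prob (@ltr01 R) [set c] = 0%E.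
Proof.
have /null_content_dominatesP h := @dominates_uniform_prob R 0 1 ltr01.
by apply: h => //; exact: lebesgue_measure_set1.
Qed.

Lemma exponential_itvoo (y : R) : 0 < y ->
  exponential_prob 1 `]0, y[ = (1 - expR (- y))%:E.
Proof.
move=> y0.
have := @exponential_prob_itv0c R 1 y y0; rewrite mulN1r EFinB => <-.
rewrite /exponential_prob (@integral_itv_bndoo _ _ _ _ true false) //.
by apply: measurable_funTS; apply/measurable_EFinP; exact: measurable_exponential_pdf.
Qed.

Lemma exponential_le0 : exponential_prob 1 `]-oo, (0 : R)] = 0%E.
Proof.
rewrite /exponential_prob -integral_itv_bndo_bndc; last first.
  by apply: measurable_funTS; apply/measurable_EFinP; exact: measurable_exponential_pdf.
apply: integral0_eq => x /=; rewrite in_itv /= => x0.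
by rewrite lt0_exponential_pdf.
Qed.

Lemma pr_law (X : {RV P >-> R}) (mu : set R -> \bar R) (A : set R) (x : R) :
  has_law P X mu -> measurable A -> mu A = x%:E -> pr P (X @^-1` A) = x.
Proof.
by move=> hX mA muA; apply: EFin_inj; rewrite prK -?muA -?hX //; exact: measurable_funPTI.
Qed.

(** For [x >= 1], [1/V > x] means [0 < V < 1/x]; the point [V = 0] is excluded because
    [0^-1 = 0]. *)
Lemma uniform_inv_pareto (V : {RV P >-> R}) :
  has_law P V (uniform_prob (@ltr01 R)) -> pareto_tail P (fun w => (V w)^-1).
Proof.
move=> hV x x1; have x0 : 0 < x by lra.
have i01 : 0 < x^-1 <= 1 by rewrite invr_gt0 x0 invf_le1.
rewrite -(pr_law hV _ (uniform_itvoo i01)) //; congr pr.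
apply/seteqP; split => w /=; rewrite in_itv /=.
  move=> h; have V0 : 0 < V w by rewrite -invr_gt0 (lt_trans x0).
  by rewrite V0 -[ltLHS]invrK ltf_pV2 ?posrE // invr_gt0.
by move=> /andP[V0 h]; rewrite -[ltLHS]invrK ltf_pV2 ?posrE // invr_gt0.
Qed.

(** The variable [Z_ij] as a function of [E_ij]; it decreases on [e > 0], so minima of exponentials
    become maxima. *)
Definition exp_score (e : R) : R := (1 - expR (- (2 * e)))^-1.

Lemma measurable_exp_score : measurable_fun setT exp_score.
Proof.
apply: (measurableT_comp measurable_inv); apply: measurable_funB => //.
apply: measurableT_comp => //; apply: measurableT_comp => //.
Qed.

(** For [x > 1] the event is [0 < E < y] with [y = - ln (1 - 1/x) / 2], and
    [exp(-y) = sqrt (1 - 1/x)]. *)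
Lemma exp_score_sqrt_tail (E : {RV P >-> R}) :
  has_law P E (exponential_prob 1) -> sqrt_tail P (exp_score \o E).
Proof.
move=> hE x x1; have x0 : 0 < x by lra.
have i0 : 0 < x^-1 by rewrite invr_gt0.
have i1 : x^-1 <= 1 by rewrite invf_le1.
have mE : measurable_fun setT E by [].
have gtE w : (x < exp_score (E w)) = (0 < E w) && (1 - x^-1 < expR (- (2 * E w))).
  rewrite /exp_score; apply/idP/andP.
    move=> h; have h0 : 0 < 1 - expR (- (2 * E w)).
      by rewrite -invr_gt0 (lt_trans x0).
    split.
      by move: h0; rewrite subr_gt0 -[ltRHS]expR0 ltr_expR; lra.
    by move: h; rewrite -[ltLHS]invrK ltf_pV2 ?posrE //; lra.
  move=> [E0 h]; have h0 : 0 < 1 - expR (- (2 * E w)).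
    by rewrite subr_gt0 -[ltRHS]expR0 ltr_expR; lra.
  by rewrite -[ltLHS]invrK ltf_pV2 ?posrE //; lra.
(* At [x = 1] the logarithm defining [y] would be taken at 0; the event is then just [0 < E]. *)
have [x1'|x1'] := eqVneq x 1.
  rewrite x1' invr1 subrr sqrtr0 subr0.
  have P1 : pr P [set w | 0 < E w] = 1.
    have := prC P (measurable_gt 0 mE); rewrite setC_gt -preimage_le.
    by rewrite (pr_law hE _ exponential_le0) //; lra.
  rewrite -[RHS]P1; congr pr; apply/seteqP; split => w /=; have := gtE w;
    rewrite x1' invr1 subrr expR_gt0 andbT => -> //.
have x1'' : 1 < x by rewrite lt_neqAle eq_sym x1'.
have i1' : x^-1 < 1 by rewrite invf_lt1.
pose y := - ln (1 - x^-1) / 2.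
have s0 : 0 < 1 - x^-1 by lra.
have y0 : 0 < y.
  by rewrite divr_gt0 // oppr_gt0 ln_lt0 // s0 /=; lra.
have <- : expR (- y) = Num.sqrt (1 - x^-1).
  apply/eqP; rewrite -(@eqrXn2 _ 2) ?expR_ge0 ?sqrtr_ge0 // sqr_sqrtr; last exact: ltW.
  rewrite -expRM_natl (_ : _ * _ = ln (1 - x^-1)) ?lnK ?posrE //.
  by rewrite /y; field.
rewrite -(pr_law hE _ (exponential_itvoo y0)) //; congr pr.
apply/seteqP; split => w /=; rewrite in_itv /= gtE => /andP[E0 h]; rewrite E0 /=.
  move: h; rewrite -{1}(lnK (_ : 1 - x^-1 \in Num.pos)) ?posrE // ltr_expR /y; lra.
rewrite -{1}(lnK (_ : 1 - x^-1 \in Num.pos)) ?posrE // ltr_expR.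
by move: h; rewrite /y; lra.
Qed.

End laws.

Arguments exp_score {R} e.
Arguments measurable_exp_score {R}.

(** * Tails of the combined statistics *)

Lemma sigma2E (R : realType) (w : 'I_3 -> R) :
  sigma2 w = w ord0 * w (lift ord0 ord0) + w ord0 * w (lift ord0 (lift ord0 ord0))
    + w (lift ord0 ord0) * w (lift ord0 (lift ord0 ord0)).
Proof.
rewrite /sigma2; under eq_bigr do rewrite big_mkcond.
by rewrite !big_ord_recl !big_ord0 /= !add0r !addr0.
Qed.

Lemma sum3E (R : realType) (F : 'I_3 -> R) :
  \sum_(i < 3) F i = F ord0 + F (lift ord0 ord0) + F (lift ord0 (lift ord0 ord0)).
Proof. by rewrite !big_ord_recl big_ord0 addr0 addrA. Qed.

(** Each score falls short of [c / u] by at most 1, and the weights sum to 1, so the weighted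
    deficit is at most 1. *)
Lemma combined_bounds d (T : measurableType d) (R : realType)
    (P : probability T R) (S : statistic) (w : 'I_3 -> R)
    (U : 'I_3 -> {RV P >-> R}) (x : T) :
  (forall i, 0 < w i) -> \sum_(i < 3) w i = 1 -> (forall i, 0 < U i x < 1) ->
  tail_const R S * (\sum_(i < 3) w i / U i x) - 1 <= combined S w U x
    <= tail_const R S * (\sum_(i < 3) w i / U i x).
Proof.
move=> w0 w1 U01; rewrite /combined mulr_sumr; apply/andP; split.
  rewrite -w1 -sumrB; apply: ler_sum => i _.
  have /andP[+ _] := score_bounds S (U01 i).
  move=> /(ler_wpM2l (ltW (w0 i))); congr (_ <= _); ring.
apply: ler_sum => i _; have /andP[_] := score_bounds S (U01 i).
move=> /(ler_wpM2l (ltW (w0 i))); congr (_ <= _); ring.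
Qed.

Section tails.
Context d (T : measurableType d) (R : realType) (P : probability T R).

(** Meant for [X] the combined statistic, [Y] the sum of the [w_i / U_i], and [N] a null event
    containing all points where some [U_i] leaves (0, 1). *)
Lemma tail_expansion_sandwich (X Y : T -> R) (N : set T) (c s : R) : 0 < c -> 0 <= s ->
  measurable_fun setT X -> measurable_fun setT Y -> measurable N -> pr P N = 0 ->
  (forall w, ~ N w -> c * Y w - 1 <= X w <= c * Y w) ->
  tail_expansion (fun t => pr P [set w | t < Y w]) 1 s ->
  tail_expansion (fun t => pr P [set w | t < X w]) c (c ^+ 2 * s).
Proof.
move=> c0 s0 mX mY mN N0 XY hY.
apply: (tail_expansion_rescale c0 s0 hY) => t; apply/andP; split.
- apply: (@le_pr_mod0 _ _ _ P _ _ N) => //; [exact: measurable_gt|exact: measurable_gt|].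
  move=> w /=; rewrite ltr_pdivrMr // => h.
  have [Nw|/XY /andP[+ _]] := pselect (N w); first by right.
  by left; lra.
- apply: (@le_pr_mod0 _ _ _ P _ _ N) => //; [exact: measurable_gt|exact: measurable_gt|].
  move=> w /= h; have [Nw|/XY /andP[_]] := pselect (N w); first by right.
  by left; rewrite /= ltr_pdivrMr // mulrC (lt_le_trans h).
Qed.

Lemma sigma2_ge0 (w : 'I_3 -> R) : (forall i, 0 < w i) -> 0 <= sigma2 w.
Proof.
by move=> w0; rewrite /sigma2; apply: sumr_ge0 => i _; apply: sumr_ge0 => j _;
  rewrite mulr_ge0 // ltW.
Qed.

Lemma shared_combined_tail (E12 E13 E23 : {RV P >-> R}) (w : 'I_3 -> R)
    (S : statistic) :
  mutually_independent P (triple E12 E13 E23) ->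
  has_law P E12 (exponential_prob 1) -> has_law P E13 (exponential_prob 1) ->
  has_law P E23 (exponential_prob 1) ->
  (forall i, 0 < w i) -> \sum_(i < 3) w i = 1 ->
  tail_expansion (prob_gt P (combined S w (marginals E12 E13 E23)))
    (tail_const R S) (tail_const R S ^+ 2 * sigma2 w).
Proof.
move=> /mutually_independent_indep3 EI h12 h13 h23 w0 w1.
have {EI}EI : indep3 P E12 E13 E23 by exact: EI.
have c0 := tail_const_gt0 R S.
have m12 : measurable_fun setT (exp_score \o E12).
  exact: measurableT_comp measurable_exp_score _.
have m13 : measurable_fun setT (exp_score \o E13).
  exact: measurableT_comp measurable_exp_score _.
have m23 : measurable_fun setT (exp_score \o E23).
  exact: measurableT_comp measurable_exp_score _.
pose Z12 := exp_score \o E12; pose Z13 := exp_score \o E13; pose Z23 := exp_score \o E23.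
pose Y x := w ord0 * Num.max (Z12 x) (Z13 x) +
  w (lift ord0 ord0) * Num.max (Z12 x) (Z23 x) +
  w (lift ord0 (lift ord0 ord0)) * Num.max (Z13 x) (Z23 x).
have hY : tail_expansion (fun t => pr P [set x | t < Y x]) 1 (sigma2 w).
  rewrite sigma2E; apply: shared_tail => //; rewrite -?sum3E //.
  - exact: indep3_comp measurable_exp_score EI.
  - exact: exp_score_sqrt_tail.
  - exact: exp_score_sqrt_tail.
  - exact: exp_score_sqrt_tail.
have mY : measurable_fun setT Y.
  by apply: measurable_funD; [apply: measurable_funD|]; apply: measurable_funM => //;
    exact: measurable_maxr.
have le0 (E : {RV P >-> R}) : has_law P E (exponential_prob 1) ->
    pr P [set x | E x <= 0] = 0.
  by move=> hE; rewrite -preimage_le (pr_law hE _ (exponential_le0 R)).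
have mle (E : {RV P >-> R}) : measurable [set x | E x <= 0] by exact: measurable_le.
pose N := [set x | E12 x <= 0] `|` [set x | E13 x <= 0] `|` [set x | E23 x <= 0].
have mN : measurable N by apply: measurableU => //; exact: measurableU.
have N0 : pr P N = 0.
  apply: prU_eq0 => //; [exact: measurableU| |exact: le0].
  by apply: prU_eq0 => //; exact: le0.
apply: (tail_expansion_sandwich c0 (sigma2_ge0 w0) _ mY mN N0 _ hY) => // x Nx.
have [e12 e13 e23] : [/\ 0 < E12 x, 0 < E13 x & 0 < E23 x].
  by split; rewrite ltNge; apply/negP => h; apply: Nx; rewrite /N /=; tauto.
have g01 (e : R) : 0 < e -> 0 < 1 - expR (- (2 * e)) < 1.
  move=> e0; rewrite subr_gt0 gtrBl expR_gt0 andbT -[ltRHS]expR0 ltr_expR; lra.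
(* The reciprocal of [1 - exp(-2 e)] decreases in [e > 0], so it exchanges minimum and maximum. *)
have gmin (e e' : R) : 0 < e -> 0 < e' ->
    (1 - expR (- (2 * Num.min e e')))^-1 = Num.max (exp_score e) (exp_score e').
  move=> e0 e0'; rewrite /exp_score.
  have /andP[p _] := g01 _ e0; have /andP[p' _] := g01 _ e0'.
  have [ee|ee] := leP e e'.
    rewrite max_l // lef_pV2 ?posrE // lerD2l lerN2 ler_expR; lra.
  rewrite max_r // lef_pV2 ?posrE // lerD2l lerN2 ler_expR; lra.
have U01 i : 0 < marginals E12 E13 E23 i x < 1.
  have min0 (e e' : R) : 0 < e -> 0 < e' -> 0 < Num.min e e' by rewrite lt_min => -> ->.
  case: (unliftP ord0 i) => [j ->|->]; last exact/g01/min0.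
  case: (unliftP ord0 j) => [k ->|->]; last exact/g01/min0.
  rewrite (ord1 k); exact/g01/min0.
have YE : \sum_(i < 3) w i / marginals E12 E13 E23 i x = Y x.
  by rewrite sum3E /Y /Z12 /Z13 /Z23 /= -!gmin.
by have := combined_bounds S w0 w1 U01; rewrite YE.
Qed.

Lemma independent_combined_tail (V : 'I_3 -> {RV P >-> R}) (w : 'I_3 -> R)
    (S : statistic) :
  mutually_independent P V ->
  (forall i, has_law P (V i) (uniform_prob (@ltr01 R))) ->
  (forall i, 0 < w i) -> \sum_(i < 3) w i = 1 ->
  tail_expansion (prob_gt P (combined S w V))
    (tail_const R S) (tail_const R S ^+ 2 * (2 * sigma2 w)).
Proof.
move=> /mutually_independent_indep3 VI hV w0 w1.
have c0 := tail_const_gt0 R S.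
have mV i : measurable_fun setT (fun x => (V i x)^-1).
  exact: measurableT_comp measurable_inv _.
pose Y x := w ord0 * (V ord0 x)^-1 + w (lift ord0 ord0) * (V (lift ord0 ord0) x)^-1 +
  w (lift ord0 (lift ord0 ord0)) * (V (lift ord0 (lift ord0 ord0)) x)^-1.
have hY : tail_expansion (fun t => pr P [set x | t < Y x]) 1 (2 * sigma2 w).
  rewrite sigma2E; apply: independent_tail => //; rewrite -?sum3E //.
  - exact: indep3_comp measurable_inv VI.
  - exact: uniform_inv_pareto.
  - exact: uniform_inv_pareto.
  - exact: uniform_inv_pareto.
have mY : measurable_fun setT Y.
  by apply: measurable_funD; [apply: measurable_funD|]; exact: measurable_funM.
pose D i := ~` (V i @^-1` `]0, 1[).
have mD i : measurable (D i) by apply: measurableC; exact: measurable_funPTI.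
have D0 i : pr P (D i) = 0.
  rewrite prC; last exact: measurable_funPTI.
  by rewrite (pr_law (hV i) _ (uniform_itvoo _)) ?subrr // ltr01 lexx.
pose N := D ord0 `|` D (lift ord0 ord0) `|` D (lift ord0 (lift ord0 ord0)).
have mN : measurable N by apply: measurableU => //; exact: measurableU.
have N0 : pr P N = 0.
  by apply: prU_eq0 => //; [exact: measurableU|exact: prU_eq0].
have s0 : 0 <= 2 * sigma2 w by rewrite mulr_ge0 // sigma2_ge0.
apply: (tail_expansion_sandwich c0 s0 _ mY mN N0 _ hY) => // x Nx.
have U01 i : 0 < V i x < 1.
  suff : ~ D i x by move=> /contrapT; rewrite /= in_itv.
  move=> Dx; apply: Nx; rewrite /N /=; move: Dx.
  case: (unliftP ord0 i) => [j ->|->]; last by left; left.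
  case: (unliftP ord0 j) => [k ->|->]; last by left; right.
  by rewrite (ord1 k); right.
by have := combined_bounds S w0 w1 U01; rewrite sum3E.
Qed.

(** One summand suffices: the score is injective on (0, 1), so the first term has no atoms, and
    adding an independent variable creates none. *)
Lemma combined_atomless (V : 'I_3 -> {RV P >-> R}) (w : 'I_3 -> R)
    (S : statistic) (t : R) :
  mutually_independent P V ->
  (forall i, has_law P (V i) (uniform_prob (@ltr01 R))) ->
  (forall i, 0 < w i) -> pr P [set x | combined S w V x = t] = 0.
Proof.
move=> /mutually_independent_indep3 VI hV w0.
have ms i : measurable_fun setT (fun x => score S (V i x)).
  exact: measurableT_comp (measurable_score S) _.
pose X x := w ord0 * score S (V ord0 x).
pose Y x := w (lift ord0 ord0) * score S (V (lift ord0 ord0) x) +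
  w (lift ord0 (lift ord0 ord0)) * score S (V (lift ord0 (lift ord0 ord0)) x).
have mX : measurable_fun setT X by exact: measurable_funM.
have mY : measurable_fun setT Y by apply: measurable_funD; exact: measurable_funM.
have XY : indep2 P X Y.
  have sI := indep3_comp (measurable_score S) VI.
  have mf : measurable_fun setT (fun z : R * R => w (lift ord0 ord0) * z.1 +
      w (lift ord0 (lift ord0 ord0)) * z.2).
    by apply: measurable_funD; exact: measurable_funM.
  have := indep3_comp2 (ms _) (ms _) (ms _) mf (indep3_rot sI).
  have m0 : measurable_fun setT (fun y : R => w ord0 * y) by exact: measurable_funM.
  exact: (indep2_comp m0 (@measurable_id _ R setT)).
have X0 c : pr P [set x | X x = c] = 0.
  have mA : measurable (~` (V ord0 @^-1` `]0, 1[)).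
    by apply: measurableC; exact: measurable_funPTI.
  have A0 : pr P (~` (V ord0 @^-1` `]0, 1[)) = 0.
    rewrite prC; last exact: measurable_funPTI.
    by rewrite (pr_law (hV ord0) _ (uniform_itvoo _)) ?subrr // ltr01 lexx.
  have mXc : measurable [set x | X x = c].
    exact: (preimage_measurable mX (measurable_set1 c)).
  have sub v : 0 < v < 1 -> w ord0 * score S v = c ->
      [set x | X x = c] `<=` [set x | V ord0 x = v] `|` ~` (V ord0 @^-1` `]0, 1[).
    move=> v01 vc x /= Xc.
    have [u01|] := pselect ((V ord0 @^-1` `]0, 1[) x); last by right.
    have u : 0 < V ord0 x < 1 by move: u01; rewrite /= in_itv.
    left; apply: (score_inj u v01 (S := S)).
    by apply: (mulfI (lt0r_neq0 (w0 ord0))); rewrite vc; exact: Xc.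
  apply/eqP; rewrite eq_le pr_ge0 andbT.
  have [[v [v01 vc]]|nv] := pselect (exists v, 0 < v < 1 /\ w ord0 * score S v = c).
    have mv : measurable [set x | V ord0 x = v].
      exact: (preimage_measurable _ (measurable_set1 v)).
    have <- : pr P [set x | V ord0 x = v] = 0.
      exact: (pr_law (hV ord0) (measurable_set1 v) (uniform_set1 v)).
    exact: (@le_pr_mod0 _ _ _ P _ _ _ mXc mv mA A0 (sub v v01 vc)).
  rewrite -A0; apply: le_pr => // x /= Xc u01; apply: nv.
  by exists (V ord0 x); split => //; move: u01; rewrite /= in_itv.
rewrite -(indep2_add_atomless t mX mY XY X0); congr pr.
by apply/seteqP; split => x /=; rewrite /combined sum3E /X /Y addrA.
Qed.

End tails.

(** * Landau notation and the final assembly *)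

Lemma eqaddO_pinfty (R : realType) (f g e : R -> R) (C T : R) :
  (forall t, T <= t -> `|f t - g t| <= C * e t) -> (forall t, 0 <= e t) ->
  f = g +O_ (+oo%R) e.
Proof.
move=> h e0; apply/eqaddOP/bigO_exP; exists (`|C| + 1) => /=.
  by rewrite ltr_wpDl.
exists T; split; first exact: num_real.
move=> t /ltW /h /le_trans; apply; rewrite (ger0_norm (e0 t)).
by apply: ler_wpM2r => //; apply: (le_trans (ler_norm C)); rewrite lerDl.
Qed.

Lemma eqaddO_at_right0 (R : realType) (f g e : R -> R) (C d : R) : 0 < d ->
  (forall a, 0 < a -> a < d -> `|f a - g a| <= C * e a) ->
  (forall a, 0 <= e a) -> f = g +O_ (0^'+) e.
Proof.
move=> d0 h e0; apply/eqaddOP/bigO_exP; exists (`|C| + 1) => /=.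
  by rewrite ltr_wpDl.
near=> a.
have a0 : 0 < a by near: a; exact: nbhs_right_gt.
have ad : a < d by near: a; exact: nbhs_right_lt.
apply: (le_trans (h _ a0 ad)); rewrite (ger0_norm (e0 a)).
by apply: ler_wpM2r => //; apply: (le_trans (ler_norm C)); rewrite lerDl.
Unshelve. all: by end_near. Qed.

Theorem mainTheorem9 (R : realType)
    (d : measure_display) (Omega : measurableType d) (P : probability Omega R)
    (E12 E13 E23 : {RV P >-> R})
    (E_indep : mutually_independent P (triple E12 E13 E23))
    (E12_exp : has_law P E12 (exponential_prob 1))
    (E13_exp : has_law P E13 (exponential_prob 1))
    (E23_exp : has_law P E23 (exponential_prob 1))
    (d' : measure_display) (Omega' : measurableType d')
    (P' : probability Omega' R)
    (V : 'I_3 -> {RV P' >-> R})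
    (V_indep : mutually_independent P' V)
    (V_unif : forall i : 'I_3, has_law P' (V i) (uniform_prob (@ltr01 R)))
    (w : 'I_3 -> R)
    (w_gt0 : forall i : 'I_3, 0 < w i)
    (w_sum1 : \sum_(i < 3) w i = 1)
    (S : statistic) :
  let PrS (t : R) : R := prob_gt P (combined S w (marginals E12 E13 E23)) t in
  let FPi (t : R) : R := distrib_fun P' (combined S w V) t in
  let q (a : R) : R := upper_quantile FPi a in
  let c : R := tail_const R S in
  [/\ ((fun t : R => PrS t - (1 - FPi t)) =
        (fun t : R => - (c ^+ 2 * sigma2 w * (ln t / t ^+ 2)))
        +O_ (+oo%R) (fun t : R => t ^- 2)),
      ((fun a : R => PrS (q a)) =
        (fun a : R => a - sigma2 w * a ^+ 2 * ln a^-1)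
        +O_ (0^'+) (fun a : R => a ^+ 2))
    & ((fun a : R => PrS (c / a)) =
        (fun a : R => a + sigma2 w * a ^+ 2 * ln a^-1)
        +O_ (0^'+) (fun a : R => a ^+ 2))].
Proof.
move=> PrS FPi q c.
have c0 : 0 < c := tail_const_gt0 R S.
have c20 : 0 < c ^+ 2 by rewrite exprn_gt0.
have hS : tail_expansion PrS c (c ^+ 2 * sigma2 w) by exact: shared_combined_tail.
pose p := prob_gt P' (combined S w V).
have hP : tail_expansion p c (c ^+ 2 * (2 * sigma2 w)) by exact: independent_combined_tail.
have mV : measurable_fun setT (combined S w V) by exact: measurable_combined.
have FE t : 1 - FPi t = p t.
  have := prC P' (measurable_gt t mV); rewrite setC_gt -preimage_le => h.
  by rewrite [FPi t]h subKr.
have s0 : 0 <= sigma2 w by exact: sigma2_ge0.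
(* The shared tail has logarithmic coefficient [c^2 sigma2 w], the independent one twice that. The
   first two claims see the difference, hence a minus sign; at [c / a] only the shared tail enters,
   hence a plus sign. *)
split.
- have [C [T h]] := tail_expansion_diff hS hP.
  apply: (@eqaddO_pinfty _ _ _ _ C T) => [t Tt|t]; last by rewrite invr_ge0 sqr_ge0.
  rewrite FE; have := h t Tt; congr (`|_ - _| <= _); ring.
- have p_dec t t' : t <= t' -> p t' <= p t.
    move=> tt'; apply: le_pr; [exact: measurable_gt|exact: measurable_gt|].
    by move=> x /=; exact: le_lt_trans.
  have pq a : 0 < a < 1 -> p (q a) = a.
    move=> a01; rewrite -FE.
    (* Existence of some quantile ensures that the chosen [q a] solves the equation instead of being
       a default value. *)
    have [q' hq'] := upper_quantile_exists mV
      (fun t => combined_atomless S t V_indep V_unif w_gt0) a01.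
    have : exists q, [set q | 1 - FPi q = a] q by exists q'; rewrite /= FE.
    by move=> /getPex.
  have p0 : 0 <= c ^+ 2 * (2 * sigma2 w) by rewrite !mulr_ge0 // ltW.
  have [C [e [e0 h]]] := tail_expansion_quantile c0 p0 hS hP p_dec pq.
  apply: (@eqaddO_at_right0 _ _ _ _ C e) => // [a a0 ae|a]; last exact: sqr_ge0.
  have := h a a0 ae; congr (`|_ - _| <= _); field; lra.
- have [C [e [e0 h]]] := tail_expansion_first_order_threshold c0 hS.
  apply: (@eqaddO_at_right0 _ _ _ _ C e) => // [a a0 ae|a]; last exact: sqr_ge0.
  have := h a a0 ae; congr (`|_ - (_ + _)| <= _); field; lra.
Qed.
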